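(* Let $G$ be a planar bipartite graph which has almost perfect matchings, with edge set $E(G)$. Then there exists $\varepsilon_G\in\{+1,-1\}^{|E(G)|}$ such that for any $t=(t_e)_{e\in E(G)}\in\mathbb{R}_{>0}^{|E(G)|}$ we have $$\mathrm{Rel}(N(t,\varepsilon_G))=X(N(t,1)),$$ where $1$ denotes the sign vector with all entries $+1$.
   Context: A planar bipartite graph $G$ is a finite bipartite graph (vertices colored black/white, edges joining opposite colors) embedded in a disk, with boundary vertices $1,\dots,n$ in clockwise order, each of degree $1$ and joined to an interior vertex (so its color is opposite to that of its neighbor). For $\varepsilon\in\{\pm1\}^{E(G)}$ and $t\in\mathbb{R}_{>0}^{E(G)}$, $N(t,\varepsilon)$ is $G$ with edge $e$ given weight $\varepsilon_e t_e$. Matching construction: an almost perfect matching $\Pi$ is a set of edges using each interior vertex exactly once and each boundary vertex at most once. $I(\Pi)\subset[n]$ consists of the used black boundary vertices and the unused white boundary vertices; all $I(\Pi)$ have the same cardinality $k$. $X(N)\in\mathrm{Gr}(k,n)$ is the point whose Plücker coordinates (maximal minors of a representing $k\times n$ matrix, up to common scalar) are $\Delta_I(N)=\sum_{I(\Pi)=I}\mathrm{wt}(\Pi)$, with $\mathrm{wt}(\Pi)$ the product of the edge weights. Relation space: let $N$ have nonzero real edge weights. For an edge $e$ with white endpoint $u$ and black endpoint $v$ (boundary vertices included with their colors), let $w(u,v)$ be the weight of $e$ and $w(v,u)=w(u,v)^{-1}$. Associate a formal variable $z_{(u,e)}$ to each half-edge $(u,e)$ (vertex $u$ incident to edge $e$),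 and consider the system $S(N)$ of linear equations: (i) $w(u,v)\,z_{(v,e)}=z_{(u,e)}$ for each edge $e=(u,v)$; (ii) $z_{(v,e)}=z_{(v,e')}$ for each interior black vertex $v$ and all edges $e,e'$ incident to $v$; (iii) $\sum_{e\ni u}z_{(u,e)}=0$ for each interior white vertex $u$. Regard each equation as a vector in $\mathbb{R}^{2|E(G)|}$ (coordinates indexed by half-edges), and let $V\cong\mathbb{R}^n$ be the coordinate subspace spanned by the half-edges $(i,e_i)$, where $e_i$ is the unique edge at boundary vertex $i$. Then $\mathrm{Rel}(N)=\mathrm{span}(S(N))\cap V$, the space of induced linear relations among $z_i=z_{(i,e_i)}$, $i=1,\dots,n$. Let $k_N=\frac12\big(n+\sum_{v\ \mathrm{black}}(\deg v-2)+\sum_{v\ \mathrm{white}}(2-\deg v)\big)$, sums over interior vertices. If $\dim\mathrm{Rel}(N)=k_N$ then $\mathrm{Rel}(N)$ is considered as a point of $\mathrm{Gr}(k_N,n)$; otherwise it is undefined. The equality in the theorem includes the assertion that $\mathrm{Rel}(N(t,\varepsilon_G))$ is defined. *)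

(* Defs.v *)
From HB Require Import structures.
From mathcomp Require Import all_boot all_order all_fingroup all_algebra.

Set Implicit Arguments.
Unset Strict Implicit.
Unset Printing Implicit Defensive.

Import GRing.Theory.
Local Open Scope ring_scope.

Definition flip (E : finType) (h : E * bool) : E * bool := (h.1, ~~ h.2).

Lemma flipK (E : finType) : involutive (@flip E).
Proof. by case=> e b; rewrite /flip /= negbK. Qed.

(* Bipartite graphs with n boundary vertices 'I_n; parallel edges are allowed.
   As the two endpoints of an edge have different colors, the half-edge (u, e)
   is encoded as (e, b), where b = true iff the endpoint u is black. *)
Record bgraph (n : nat) := BGraph {
  ivert : finType;
  edge : finType;
  black : ivert + 'I_n -> bool;
  vert : edge * bool -> ivert + 'I_n;
  black_vert : forall e b, black (vert (e, b)) = b;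
  (* The unique half-edge at a boundary vertex. *)
  bhalf : 'I_n -> edge * bool;
  bhalfP : forall i h, (vert h == inr i) = (h == bhalf i);
  bhalf_int : forall i, exists v, vert (flip (bhalf i)) = inl v
}.

Arguments black {n} G _ : rename.
Arguments bhalf {n} G _ : rename.

Definition half_edge (n : nat) (G : bgraph n) : finType := (edge G * bool)%type.

Definition flip_perm (n : nat) (G : bgraph n) : {perm half_edge G} :=
  perm (can_inj (@flipK (edge G))).

(* An embedding in the disk, as a combinatorial map: rot sends each half-edge
   to the next one, counterclockwise, around its vertex.  The complement of the
   disk in the sphere is shrunk to a point, so that the boundary vertices become
   a single vertex of the map; the boundary order 1, ..., n, which is clockwise
   seen from the disk, is counterclockwise around that point.  The last field is
   Euler's formula V + F = E + 2C, which says that each connected component of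
   the map has genus 0 (the faces are counted componentwise). *)
Record disk_embedding (n : nat) (G : bgraph n) := DiskEmbedding {
  rot : {perm half_edge G};
  rot_int : forall (v : ivert G) (h : half_edge G),
    vert h = inl v -> porbit rot h = [set h' | vert h' == inl v];
  rot_boundary : forall i : 'I_n, rot (bhalf G i) = bhalf G (ordS i);
  rot_planar :
    (#|porbits rot| + #|porbits (rot * flip_perm G)%g|
     = #|porbits (flip_perm G)|
       + 2 * #|[set orbit 'P <<[set rot; flip_perm G]>>%g h
               | h : half_edge G]|)%N
}.

Record planar_bgraph (n : nat) := PlanarBGraph {
  pgraph :> bgraph n;
  pembedding : disk_embedding pgraph
}.

Section Matchings.
Variables (n : nat) (G : bgraph n).

Definition incident (e : edge G) (v : ivert G + 'I_n) : bool :=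
  (vert (e, true) == v) || (vert (e, false) == v).

Definition matching_deg (Pi : {set edge G}) (v : ivert G + 'I_n) : nat :=
  #|[set e in Pi | incident e v]|.

Definition almost_perfect (Pi : {set edge G}) : bool :=
  [forall v : ivert G, matching_deg Pi (inl v) == 1%N]
  && [forall i : 'I_n, (matching_deg Pi (inr i) <= 1)%N].

Definition matching_boundary (Pi : {set edge G}) : {set 'I_n} :=
  [set i | if black G (inr i) then matching_deg Pi (inr i) == 1%N
           else matching_deg Pi (inr i) == 0%N].

Variables (R : fieldType) (w : edge G -> R).

Definition matching_plucker (I : {set 'I_n}) : R :=
  \sum_(Pi | almost_perfect Pi && (matching_boundary Pi == I)) \prod_(e in Pi) w e.

End Matchings.

(* U is the point of Gr(k, n) with Plücker coordinates p, up to a common nonzero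
   scalar.  A k-subset I of 'I_n is given by its increasing enumeration f. *)
Definition has_plucker (R : fieldType) (k n : nat) (U : {vspace 'rV[R]_n})
    (p : {set 'I_n} -> R) : Prop :=
  exists A : 'M[R]_(k, n),
    [/\ \dim U = k,
        U = <<[seq row i A | i : 'I_k]>>%VS
      & exists2 c : R, c != 0 &
          forall f : 'I_k -> 'I_n, {homo f : i j / (i < j)%N} ->
            \det (colsub f A) = c * p [set f j | j : 'I_k]].

(* U = X(N), for N the network with graph G and weights w. *)
Definition is_matching_point (R : fieldType) (n : nat) (G : bgraph n)
    (w : edge G -> R) (U : {vspace 'rV[R]_n}) : Prop :=
  exists k : nat,
    (forall Pi : {set edge G}, almost_perfect Pi -> #|matching_boundary Pi| = k)
    /\ has_plucker k U (matching_plucker w).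

Section Relations.
Variables (R : fieldType) (n : nat) (G : bgraph n) (w : edge G -> R).

Let hspace := {ffun half_edge G -> R^o}.

Definition zvar (h : half_edge G) : hspace := [ffun h' => (h' == h)%:R].

(* As w e is the weight w(u, v) with u white and v black, this is
   w(u, v) z_(v, e) = z_(u, e). *)
Definition edge_relation (e : edge G) : hspace :=
  w e *: zvar (e, true) - zvar (e, false).

Definition black_relation (h h' : half_edge G) : hspace := zvar h - zvar h'.

Definition white_relation (u : ivert G) : hspace :=
  \sum_(h : half_edge G | vert h == inl u) zvar h.

Definition relation_system : seq hspace :=
  [seq edge_relation e | e : edge G]
  ++ flatten [seq [seq black_relation h h' |
                     h <- enum [set h : half_edge G | vert h == inl v],
                     h' <- enum [set h : half_edge G | vert h == inl v]]
             | v <- enum (ivert G) & black G (inl v)]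
  ++ [seq white_relation u | u <- enum (ivert G) & ~~ black G (inl u)].

Definition boundary_space : {vspace hspace} :=
  <<[seq zvar (bhalf G i) | i : 'I_n]>>%VS.

Definition boundary_coords (z : hspace) : 'rV[R]_n := \row_i z (bhalf G i).

Lemma boundary_coords_is_linear : linear boundary_coords.
Proof. by move=> a x y; apply/rowP=> i; rewrite !mxE !ffunE. Qed.

HB.instance Definition _ :=
  GRing.isLinear.Build R hspace 'rV[R]_n _ boundary_coords
    boundary_coords_is_linear.

(* span(S(N)) :&: V, transported to R^n along the isomorphism V -> R^n. *)
Definition Rel : {vspace 'rV[R]_n} :=
  (linfun boundary_coords @: (<<relation_system>> :&: boundary_space))%VS.

Definition degree (v : ivert G) : nat := #|[set h : half_edge G | vert h == inl v]|.

Definition kN : rat :=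
  (n%:R + \sum_(v : ivert G | black G (inl v)) ((degree v)%:R - 2)
        + \sum_(v : ivert G | ~~ black G (inl v)) (2 - (degree v)%:R)) / 2.

Definition Rel_defined : Prop := (\dim Rel)%:R = kN.

End Relations.

(* The weights of N(t, eps). *)
Definition signed_weight (R : fieldType) (n : nat) (G : bgraph n)
  (t eps : edge G -> R) : edge G -> R := fun e => eps e * t e.

(* Main.v *)
Require Import Defs.
From mathcomp Require Import all_boot all_order all_fingroup all_algebra.
From mathcomp Require Import reals zify lra.

Set Implicit Arguments.
Unset Strict Implicit.
Unset Printing Implicit Defensive.

Import Order.TTheory GRing.Theory Num.Theory.

(** Eliminating the half-edge variables at white vertices and identifying those at each
  black interior vertex turns the system S(N) into one equation for each white vertex:
  the sum of the w z_v over the neighbors v of an interior vertex is zero, and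
  z_i = w z_v for a boundary vertex i with neighbor v.  The columns are the black
  interior vertices and all boundary vertices.  The space Rel(N) consists of the
  combinations of rows that vanish on the columns of the black interior vertices, so its
  Pluecker coordinate at I is, up to a common factor, the minor with these columns and
  those of I (det_relation_basis, Rel_basis).  Expanded by the Leibniz formula, this minor
  has one term for each almost perfect matching P with I(P) = I, namely the weight of P
  with the sign of a bijection from rows to columns (det_network_minor).  It remains to
  choose signs of the edges that make the signs of all these terms equal, for all I
  (kasteleyn_signs).  Then some minor is nonzero, which also yields the dimension of
  Rel(N).

  This is a version of the theorem of Kasteleyn for graphs in a disk.  Suppose first that
  I(P) = I(Q).  The symmetric difference of P and Q is a union of cycles, and the signs
  of the two terms differ by the sign of a permutation that walks along these cycles.
  Since the map is planar, the cycles together bound a union S of faces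
  (even_edges_bound).  The walk along the boundary of S is a product of three
  permutations, which run around the faces of S, flip its inner edges and turn around its
  vertices; so its sign is given by an Euler characteristic modulo 2
  (odd_boundary_walk).  The vertices inside S are paired by P, and the sign becomes a sum
  over the faces of S of a parity that depends on the face only (odd_tail_walk_count,
  region_parity_sum).  Signs of the edges with the corresponding products around the
  faces exist by linear algebra modulo 2 (coboundary_exists): the condition is that the
  parities add up to zero over a union S of faces without boundary, and this is the
  comparison of P with itself.

  If I(P) and I(Q) differ by exchanging one element a for another element b, then the
  symmetric difference also contains a path from b to a, which becomes a cycle through
  the point at infinity of the map.  Sorting the columns contributes a sign that depends
  on the number of common elements between a and b, and the half-edges of S at infinity
  contribute the same sign (odd_exchanged_boundary).  In general, P is transformed by
  such exchanges into a matching with the boundary of Q, each time switching P along one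
  path of the symmetric difference (exchange_path). *)

Local Open Scope group_scope.

(** * Signs of permutations *)

Section PermSigns.
Variable T : finType.
Implicit Types (p q a b : {perm T}) (S Z : {set T}).

Definition stable p S := forall x, x \in S -> p x \in S.

Lemma stableP p S : stable p S -> forall x, (p x \in S) = (x \in S).
Proof.
move=> pS; have pSE : p @: S = S.
  apply/eqP; rewrite eqEcard card_imset ?leqnn ?andbT; last exact: perm_inj.
  by apply/subsetP=> _ /imsetP[x xS ->]; apply: pS.
by move=> x; rewrite -{1}pSE mem_imset //; apply: perm_inj.
Qed.

Lemma restrE p S : stable p S ->
  forall x, restr_perm S p x = if x \in S then p x else x.
Proof.
move=> pS x; have pN : p \in 'N(S | 'P).
  by rewrite inE; apply/andP; split; rewrite ?inE //; apply/subsetP=> y yS; rewrite inE; apply: pS.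
case: ifP => [xS|/negbT xS]; first by rewrite restr_permE.
exact: (out_perm (restr_perm_on S p)).
Qed.

(** A fixed point adds as much to the number of points as to the number of cycles, so
  both may be counted in S only. *)
Lemma odd_perm_on p S : (forall x, x \notin S -> p x = x) ->
  odd_perm p = odd #|S| (+) odd #|porbit p @: S|.
Proof.
move=> pfix.
have fixo x : x \notin S -> porbit p x = [set x].
  move=> xS; apply/setP=> y; rewrite inE; apply/porbitP/eqP => [[i ->]|->].
    by elim: i => [|i IH]; rewrite ?expg0 ?perm1 // expgSr permM IH pfix.
  by exists 0; rewrite expg0 perm1.
have stabS : stable p S.
  move=> x xS; apply/negPn/negP => pxS.
  by have := pfix _ pxS => /perm_inj E; rewrite E xS in pxS.
have -> : odd_perm p = odd #|T| (+) odd #|porbits p| by [].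
have -> : porbits p = porbit p @: S :|: porbit p @: ~: S.
  by rewrite -imsetU setUCr; apply/setP=> O; apply/imsetP/imsetP=> -[x _ ->]; exists x.
rewrite cardsU disjoint_setI0 ?cards0 ?subn0; last first.
  apply/pred0P=> O /=; apply/negP=> /andP[/imsetP[x xS ->] /imsetP[y]].
  rewrite inE => yS E; move: (porbit_id p x); rewrite E (fixo _ yS) inE => /eqP xy.
  by move/negP: yS; rewrite -xy.
rewrite oddD [X in _ (+) (_ (+) odd X)]card_in_imset; last first.
  by move=> x y; rewrite !inE => xS yS; rewrite !fixo // => /set1_inj.
rewrite -(cardsC S) oddD; by do 3!case: (odd _).
Qed.

(** p is the product of the disjoint transpositions of z and p z, for z in Z. *)
Lemma odd_involution p Z :
  (forall x, x \in Z -> p x \notin Z) -> (forall x, x \in Z -> p (p x) = x) ->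
  (forall x, x \notin Z -> p x != x -> p x \in Z) -> odd_perm p = odd #|Z|.
Proof.
elim: {Z}_.+1 {-2}Z p (ltnSn #|Z|) => // m IH Z p ltm h1 h2 h3.
have [Z0|[x xZ]] := set_0Vmem Z.
  rewrite Z0 cards0 (_ : p = 1) ?odd_perm1 //; apply/permP=> y; rewrite perm1.
  by apply/eqP/negPn/negP=> py; have := h3 y; rewrite Z0 !inE => /(_ isT py).
have px : p x != x by apply: contraNneq (h1 x xZ) => ->.
have -> : odd_perm p = ~~ odd_perm (p * tperm x (p x)).
  by rewrite odd_permM odd_tperm eq_sym px addbT negbK.
have q1 : (p * tperm x (p x)) x = x by rewrite permM tpermR.
have q2 : (p * tperm x (p x)) (p x) = p x by rewrite permM h2 // tpermL.
have qE y : y != x -> y != p x -> (p * tperm x (p x)) y = p y.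
  move=> n1 n2; rewrite permM tpermD //.
    by apply: contraNneq n2 => E; apply/eqP/(@perm_inj _ p); rewrite h2.
  by rewrite (inj_eq perm_inj) eq_sym.
rewrite (cardsD1 x) xZ add1n /=; congr negb.
have ZE y : y \in Z :\ x -> [/\ y \in Z, y != x & y != p x].
  rewrite !inE => /andP[yx yZ]; split=> //.
  by apply: contraNneq (h1 x xZ) => <-.
apply: IH.
- by rewrite [X in X <= _](_ : _ = #|Z|) // [RHS](cardsD1 x) xZ.
- move=> y /ZE[yZ n1 n2]; rewrite qE // !inE negb_and (negbTE (h1 _ yZ)).
  by rewrite orbT.
- move=> y /ZE[yZ n1 n2]; rewrite !qE ?h2 //.
    by apply: contraNneq (h1 y yZ) => ->.
  by rewrite (inj_eq perm_inj).
- move=> y; rewrite !inE negb_and negbK.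
  have [->|n1 /= yZ] := eqVneq y x; first by rewrite q1 eqxx.
  have [->|n2] := eqVneq y (p x); first by rewrite q2 eqxx.
  rewrite qE // => py; rewrite h3 // andbT.
  by apply: contraNneq n2 => E; rewrite -(perm_inj (h2 _ (h3 _ yZ py))) E.
Qed.

End PermSigns.

(** Transport of the sign between two types. One transposition is removed at a time, on
  both sides. *)
Lemma odd_perm_transfer (A B : finType) (p : {perm A}) (q : {perm B})
    (D : {set A}) (f : A -> B) : {in D &, injective f} ->
  (forall x, x \notin D -> p x = x) ->
  (forall x, x \in D -> q (f x) = f (p x)) ->
  (forall y, y \notin f @: D -> q y = y) -> odd_perm p = odd_perm q.
Proof.
move=> finj; elim: {p}_.+1 {-2}p q (ltnSn #|[set x | p x != x]|) => // m IH p q ltm pD qf qD.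
have pS : forall x, x \in D -> p x \in D.
  move=> x xD; apply/negPn/negP=> pxD.
  by have := pD _ pxD => /perm_inj E; rewrite E xD in pxD.
have [Z0|[x]] := set_0Vmem [set x | p x != x].
  have p1 : p = 1.
    apply/permP=> y; rewrite perm1; apply/eqP/negPn/negP=> py.
    by have := in_set0 y; rewrite -Z0 inE py.
  have -> : q = 1; last by rewrite p1 !odd_perm1.
  apply/permP=> y; rewrite perm1; have [/imsetP[x xD ->]|] := boolP (y \in f @: D).
    by rewrite qf // p1 perm1.
  by apply: qD.
rewrite inE => px; have xD : x \in D by apply/negPn/negP=> /pD E; rewrite E eqxx in px.
have fx : f x != f (p x) by rewrite (inj_in_eq finj) ?pS // eq_sym.
have -> : odd_perm p = ~~ odd_perm (p * tperm x (p x)).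
  by rewrite odd_permM odd_tperm eq_sym px addbT negbK.
have -> : odd_perm q = ~~ odd_perm (q * tperm (f x) (f (p x))).
  by rewrite odd_permM odd_tperm fx addbT negbK.
congr negb; apply: IH.
- rewrite -ltnS; apply: leq_trans ltm; rewrite ltnS; apply: proper_card.
  rewrite properE; apply/andP; split; last first.
    by apply/subsetPn; exists x; rewrite inE // permM tpermR eqxx.
  apply/subsetP=> y; rewrite !inE permM; apply: contra => /eqP E; rewrite E tpermD //.
    by apply: contraNneq px => xy; rewrite -xy in E; rewrite E.
  by apply: contraNneq px => xy; rewrite -xy in E; rewrite (perm_inj E).
- move=> y yD; rewrite permM (pD y) // tpermD //; first by apply: contraNneq yD => <-.
  by apply: contraNneq yD => <-; apply: pS.
- move=> y yD; rewrite !permM (qf y) //.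
  by case: (tpermP x (p x) (p y)) => [->|->|/eqP n1 /eqP n2];
    rewrite ?tpermL ?tpermR // tpermD // (inj_in_eq finj) ?pS // eq_sym.
- move=> y yD; rewrite permM (qD y) // tpermD //; apply: contraNneq yD => <-; apply: imset_f => //.
  exact: pS.
Qed.

(** The first return of w to the complement of N. To skip x is to multiply by the
  transposition of x and w x; these transpositions are disjoint as no two points of N
  are consecutive. *)
Lemma odd_first_return (T : finType) (w : {perm T}) (N : {set T}) :
  (forall x, x \in N -> w x \notin N) ->
  exists2 r : {perm T},
    (forall x, r x = if x \in N then x else if w x \in N then w (w x) else w x) &
    odd_perm r = odd_perm w (+) odd #|N|.
Proof.
move=> wN; pose f x := if x \in N then x else if w x \in N then w (w x) else w x.
have f_inj : injective f.
  have f_out x y : x \in N -> f y = x -> y = x.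
    rewrite /f => xN; case: ifP => // yN; case: ifP => wyN yx.
      by have := wN _ wyN; rewrite yx xN.
    by rewrite yx xN in wyN.
  move=> x y; case: (boolP (x \in N)) => xN.
    by rewrite {1}/f xN => /esym/(f_out _ _ xN).
  case: (boolP (y \in N)) => yN; first by rewrite {2}/f yN => /(f_out _ _ yN).
  rewrite /f (negbTE xN) (negbTE yN); case: ifP => wxN; case: ifP => wyN //; last by move/perm_inj.
  - by move/perm_inj/perm_inj.
  - by move/perm_inj => E; rewrite -E wxN in yN.
  - by move/perm_inj => E; rewrite E wyN in xN.
have rE x : perm f_inj x = f x by rewrite permE.
exists (perm f_inj) => //; move: rE; move: (perm _) => r rE {f_inj}.
have := @odd_involution _ (w^-1 * r) N; rewrite odd_permM odd_permV => <-.
- by case: (odd_perm w); case: (odd_perm r).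
- move=> x xN; rewrite permM rE /f.
  case: ifP => [y1|y1]; first by apply: contraTN y1 => h; have := wN _ h; rewrite permKV xN.
  by rewrite permKV xN wN.
- move=> x xN; rewrite !permM (rE (w^-1 x)) /f.
  have y1 : (w^-1 x) \in N = false.
    by apply/negbTE/negP=> h; have := wN _ h; rewrite permKV xN.
  by rewrite y1 permKV xN permK (rE x) /f xN.
- move=> x xN; rewrite permM rE /f permKV (negbTE xN).
  by case: ifP => // _; rewrite eqxx.
Qed.

(** The form of odd_perm_transfer in which the identification is a relation, for partial
  bijections without a default value. *)
Lemma odd_perm_correspondence (A B : finType) (p : {perm A}) (q : {perm B})
    (D : {set A}) (D' : {set B}) (R : A -> B -> bool) :
  (forall x, x \in D -> exists2 y, y \in D' & R x y) ->
  (forall y, y \in D' -> exists2 x, x \in D & R x y) ->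
  (forall x y y', R x y -> R x y' -> y = y') ->
  (forall x x' y, x \in D -> x' \in D -> R x y -> R x' y -> x = x') ->
  (forall x, x \notin D -> p x = x) -> (forall y, y \notin D' -> q y = y) ->
  (forall x y, x \in D -> R x y -> R (p x) (q y)) -> odd_perm p = odd_perm q.
Proof.
move=> RD RD' Rfun Rinj pD qD Rpq.
have pS : forall x, x \in D -> p x \in D.
  move=> x xD; apply/negPn/negP=> pxD.
  by have := pD _ pxD => /perm_inj E; rewrite E xD in pxD.
have [D0|[x0 x0D]] := set_0Vmem D.
  have -> : p = 1 by apply/permP=> x; rewrite perm1 pD // D0 inE.
  have -> : q = 1; last by rewrite !odd_perm1.
  apply/permP=> y; rewrite perm1 qD //; apply/negP=> /RD'[x].
  by rewrite D0 inE.
have [y0 _ _] := RD _ x0D.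
pose f x := odflt y0 [pick y | R x y].
have fR x : x \in D -> R x (f x).
  by move=> /RD[y _ xy]; rewrite /f; case: pickP => //= /(_ y); rewrite xy.
apply: (@odd_perm_transfer _ _ _ _ D f) => //.
- by move=> x x' xD x'D E; apply: (Rinj _ _ (f x) xD x'D); rewrite ?fR // E fR.
- by move=> x xD; apply: (Rfun (p x)); [exact: Rpq (fR _ xD) | apply/fR/pS].
- move=> y yD; apply: qD; apply: contraNN yD => /RD'[x xD xy].
  by apply/imsetP; exists x => //; apply: (Rfun x) => //; exact: fR.
Qed.

(** The involutions a and b generate a dihedral group on C. On each of its orbits their
  product has two cycles, which a exchanges and inverts; S contains one of them, and so
  does U. *)
Lemma odd_dihedral (T : finType) (a b : {perm T}) (C S U : {set T}) :
  (forall x, x \in C -> [/\ a x \in C, b x \in C, a (a x) = x & b (b x) = x]) ->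
  (forall x, x \in C -> [/\ (a x \in S) = (x \notin S), (b x \in S) = (x \notin S),
    (a x \in U) = (x \notin U) & (b x \in U) = (x \notin U)]) ->
  odd_perm (restr_perm (C :&: S) (b * a)) = odd_perm (restr_perm (C :&: U) (a * b)).
Proof.
move=> abC abSU.
have stab (p q : {perm T}) (Q : {set T}) : 
   (forall x, x \in C -> [/\ p x \in C, q x \in C & (q x \in Q) = (x \notin Q)]) ->
   (forall x, x \in C -> (p x \in Q) = (x \notin Q)) -> stable (p * q) (C :&: Q).
  move=> h1 h2 x; rewrite !inE permM => /andP[xC xQ].
  have [pC qC qQ] := h1 _ xC; have [ppC qpC qpQ] := h1 _ pC.
  by rewrite qpC qpQ h2 // xQ.
have stab2 (p : {perm T}) Q1 Q2 : stable p Q1 -> stable p Q2 -> stable p (Q1 :&: Q2).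
  by move=> h1 h2 x; rewrite !inE => /andP[x1 x2]; rewrite h1 ?h2.
have baS : stable (b * a) (C :&: S).
  by apply: stab => x xC; have [? ? ? ?] := abC _ xC; have [? ? ? ?] := abSU _ xC.
have baU : stable (b * a) (C :&: U).
  by apply: stab => x xC; have [? ? ? ?] := abC _ xC; have [? ? ? ?] := abSU _ xC.
have abU : stable (a * b) (C :&: U).
  by apply: stab => x xC; have [? ? ? ?] := abC _ xC; have [? ? ? ?] := abSU _ xC.
have baS' : stable (b * a) (C :&: ~: S).
  by apply: stab => x xC; have [? ? ? ?] := abC _ xC; have [h1 h2 ? ?] := abSU _ xC;
    rewrite ?inE ?h1 ?h2.
have baU' : stable (b * a) (C :&: ~: U).
  by apply: stab => x xC; have [? ? ? ?] := abC _ xC; have [? ? h1 h2] := abSU _ xC;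
    rewrite ?inE ?h1 ?h2.
set p := b * a in baS baU baS' baU' *.
have inv : restr_perm (C :&: U) (a * b) = (restr_perm (C :&: U) p)^-1.
  apply/permP=> x; apply: (@perm_inj _ (restr_perm (C :&: U) p)).
  rewrite permKV (restrE abU) (restrE baU).
  case: (boolP (x \in C :&: U)) => xU; last by rewrite (negbTE xU).
  rewrite (stableP abU) xU !permM.
  move: xU; rewrite inE => /andP[xC _].
  by have [aC _ aa _] := abC _ xC; have [_ _ _ ->] := abC _ aC.
rewrite inv odd_permV.
have split (Q Q' : {set T}) : stable p (C :&: Q) -> stable p (C :&: Q') -> stable p (C :&: ~: Q') ->
   odd_perm (restr_perm (C :&: Q) p) =
   odd_perm (restr_perm (C :&: Q :&: Q') p) (+) odd_perm (restr_perm (C :&: Q :&: ~: Q') p).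
  move=> h1 h2 h3; rewrite -odd_permM; congr odd_perm; apply/permP=> x.
  have h4 : stable p (C :&: Q :&: Q').
    by rewrite -?setIA setIIr; apply: stab2.
  have h5 : stable p (C :&: Q :&: ~: Q').
    by rewrite -?setIA setIIr; apply: stab2.
  rewrite permM (restrE h4).
  case: ifP => xQ'.
    rewrite (restrE h5) (restrE h1).
    move: xQ' (h4 _ xQ'); rewrite !inE => /andP[/andP[-> ->] _] /andP[_ ->].
    by rewrite andbF.
  rewrite (restrE h5) (restrE h1); move: xQ'; rewrite !inE.
  by case: (x \in C); case: (x \in Q) => //= ->.
rewrite (split S U) // (split U S) // -!setIA (setIC U S); congr (_ (+) _).
have st1 : stable p (C :&: (S :&: ~: U)).
  by rewrite -?setIA setIIr; apply: stab2.
have st2 : stable p (C :&: (U :&: ~: S)).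
  by rewrite -?setIA setIIr; apply: stab2.
rewrite -[RHS]odd_permV.
have aD x : x \in C -> (a x \in C :&: (U :&: ~: S)) = (x \in C :&: (S :&: ~: U)).
  move=> xC; have [aC _ _ _] := abC _ xC; have [aS _ aU _] := abSU _ xC.
  by rewrite !inE aC aS aU xC /= negbK andbC.
have symdiff x (Q : {set T}) : x \in C :&: Q -> x \in C by rewrite inE => /andP[].
apply: (@odd_perm_transfer _ _ _ _ (C :&: (S :&: ~: U)) a).
- by move=> x y _ _ /perm_inj.
- by move=> x xD; rewrite (restrE st1) (negbTE xD).
- move=> x xD; have xC := symdiff _ _ xD; apply: (@perm_inj _ (restr_perm (C :&: (U :&: ~: S)) p)).
  rewrite permKV (restrE st1) xD (restrE st2) aD ?st1 //; last exact: symdiff (st1 _ xD).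
  rewrite permM; have [_ bC _ _] := abC _ xC; have [_ _ aa _] := abC _ bC.
  by rewrite {1}/p permM aa; have [_ _ _ ->] := abC _ xC.
- move=> y yD; apply: (@perm_inj _ (restr_perm (C :&: (U :&: ~: S)) p)).
  rewrite permKV (restrE st2); case: ifP => // yU; case/negP: yD.
  have yC := symdiff _ _ yU; have [aC _ aa _] := abC _ yC.
  by apply/imsetP; exists (a y); rewrite ?aa // -aD // aa.
Qed.

Lemma porbit_step (T : finType) (p : {perm T}) x y :
  (p y \in porbit p x) = (y \in porbit p x).
Proof. by rewrite -!eq_porbit_mem -{1}(porbit_perm p 1 y) expg1. Qed.

Lemma porbit_ind (T : finType) (p : {perm T}) (P : T -> Prop) x :
  P x -> (forall y, y \in porbit p x -> P y -> P (p y)) ->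
  forall y, y \in porbit p x -> P y.
Proof.
move=> Px Ps y /porbitP[i ->]; elim: i => [|i IH]; first by rewrite expg0 perm1.
by rewrite expgSr permM; apply: Ps => //; rewrite mem_porbit.
Qed.

(** * The walk along the boundary of a region of a map *)

Section Surface.
(* The half-edges T form a map with rotation s and flip a; the faces are the orbits of
  s * a, and S is a union of faces. *)
Variables (T : finType) (s a : {perm T}) (col : T -> bool).
Hypothesis aK : forall x, a (a x) = x.
Hypothesis acol : forall x, col (a x) = ~~ col x.
Variable S : {set T}.
Hypothesis S_face : forall x, (a (s x) \in S) = (x \in S).

Definition rim := [set x | (x \in S) (+) (a x \in S)].

Lemma rimE x : (x \in rim) = (x \in S) (+) (a x \in S).
Proof. by rewrite inE. Qed.

Lemma rim_a x : (a x \in rim) = (x \in rim).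
Proof. by rewrite !rimE aK addbC. Qed.

(** Turning around a vertex, one enters or leaves S by crossing an edge of the rim. *)
Lemma region_step x : (s x \in S) = (x \in S) (+) (s x \in rim).
Proof. by rewrite rimE S_face; case: (x \in S); case: (s x \in S). Qed.

Lemma region_flip x : x \in rim -> (a x \in S) = (x \notin S).
Proof. by rewrite rimE; case: (x \in S); case: (a x \in S). Qed.

(* A vertex has at most two half-edges of the rim, and b exchanges them. *)
Variable b : {perm T}.
Hypothesis bC : forall x, x \in rim -> b x \in rim.
Hypothesis b_neq : forall x, x \in rim -> b x != x.
Hypothesis b_orbit : forall x, x \in rim -> b x \in porbit s x.
Hypothesis b_uniq : forall x y, x \in rim -> y \in rim -> y \in porbit s x -> y = x \/ y = b x.

Lemma pairingK x : x \in rim -> b (b x) = x.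
Proof.
move=> xC; have bxC := bC xC; case: (b_uniq xC (bC bxC)) => //.
  rewrite -(eqP (_ : porbit s (b x) == porbit s x)) ?b_orbit //.
  by rewrite eq_porbit_mem b_orbit.
by move=> E; have := b_neq bxC; rewrite E eqxx.
Qed.

(** The two half-edges of the rim at a vertex separate a sector in S from a sector
  outside; each sector is entered through one of them. *)
Lemma region_pairing x : x \in rim -> (b x \in S) = (x \notin S).
Proof.
move=> xC; apply/idP/idP => [|xS]; [apply: contraL | apply: contraNT xS] => xS.
- apply/negP=> bxS.
  have all : forall y, y \in porbit s x -> y \in S.
    apply: porbit_ind => // y yx yS; rewrite region_step yS /=.
    apply/negP=> sC; have syx : s y \in porbit s x by rewrite porbit_step.
    have : s y \in S by case: (b_uniq xC sC syx) => ->.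
    by rewrite region_step yS sC.
  have := region_step (s^-1 x); rewrite permKV xS xC all //.
  by rewrite -porbit_step permKV porbit_id.
- apply/negPn/negP=> xnS.
  have all : forall y, y \in porbit s x -> y \notin S.
    apply: porbit_ind => // y yx yS; rewrite region_step (negbTE yS) /=.
    apply/negP=> sC; have syx : s y \in porbit s x by rewrite porbit_step.
    have : s y \notin S by case: (b_uniq xC sC syx) => ->.
    by rewrite region_step (negbTE yS) sC.
  have := region_step (s^-1 x); rewrite permKV (negbTE xnS) xC (negbTE (all _ _)) //.
  by rewrite -porbit_step permKV porbit_id.
Qed.

Let flipS x := if (x \in S) && (a x \in S) then a x else x.

Let flipS_K : involutive flipS.
Proof.
by move=> x; rewrite /flipS; case E: ((x \in S) && (a x \in S)); rewrite ?aK ?E // andbC E.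
Qed.

(* faceS runs around the faces of S, aS flips the edges inside S, tau walks along the
  rim with S on one side, and vertS is the part of the rotation that lies in S. *)
Let aS := perm (can_inj flipS_K).

Let faceS := restr_perm S (s * a).
Let tau := restr_perm (rim :&: S) (b * a).
Let vertS := faceS * aS * tau^-1.

Let face_stable : stable (s * a) S.
Proof. by move=> x xS; rewrite permM S_face. Qed.

Let tau_stable : stable (b * a) (rim :&: S).
Proof.
move=> x; rewrite !in_setI permM => /andP[xC xS].
rewrite rim_a bC //=.
by rewrite region_flip ?bC // region_pairing // xS.
Qed.

(** At the end of a sector in S, vertS jumps back to its beginning. *)
Lemma vertSE x : vertS x = if x \in S then (if s x \in S then s x else b (s x)) else x.
Proof.
rewrite /vertS !permM (restrE face_stable) /aS permE /flipS.
have tauV y : y \notin rim :&: S -> tau^-1 y = y.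
  by move=> yC; apply: (@perm_inj _ tau); rewrite permKV (restrE tau_stable) (negbTE yC).
case: (boolP (x \in S)) => xS.
  rewrite permM S_face xS aK /=; case: ifP => sxS.
    by apply: tauV; move: (region_step x); rewrite xS sxS in_setI; case: (_ \in rim).
  apply: (@perm_inj _ tau); rewrite permKV (restrE tau_stable).
  have sC : s x \in rim by move: (region_step x); rewrite xS sxS; case: (_ \in rim).
  by rewrite in_setI bC // region_pairing // sxS /= permM pairingK.
by rewrite (negbTE xS) /= tauV // in_setI (negbTE xS) andbF.
Qed.

Lemma porbit_faceS x : x \in S -> porbit faceS x = porbit (s * a) x.
Proof.
move=> xS; apply/setP=> y.
have E i : (faceS ^+ i) x = ((s * a) ^+ i) x /\ ((s * a) ^+ i) x \in S.
  elim: i => [|i [IH1 IH2]]; first by rewrite !expg0 !perm1.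
  by rewrite !expgSr !permM IH1 (restrE face_stable) IH2 S_face permM.
by apply/porbitP/porbitP => -[i ->]; exists i; case: (E i).
Qed.

(** A vertex has at most one sector in S, so its half-edges in S form a single cycle. *)
Lemma porbit_vertS x : x \in S -> porbit vertS x = porbit s x :&: S.
Proof.
move=> xS; apply/eqP; rewrite eqEsubset; apply/andP; split.
  have b_orbit' z y : s z \in rim -> z \in porbit s y -> b (s z) \in porbit s y.
    move=> sC zy; have := b_orbit sC; rewrite -!eq_porbit_mem => /eqP ->.
    by rewrite eq_porbit_mem porbit_step.
  apply/subsetP; apply: porbit_ind => [|y _]; first by rewrite in_setI porbit_id.
  rewrite !in_setI vertSE => /andP[yx yS]; rewrite yS.
  case: ifP => sS; first by rewrite porbit_step yx sS.
  have sC : s y \in rim by move: (region_step y); rewrite yS sS; case: (_ \in rim).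
  by rewrite b_orbit' // region_pairing // sS.
apply/subsetP=> z; rewrite in_setI => /andP[zx zS].
pose P y : Prop := if y \in S then is_true (y \in porbit vertS x) else
  forall d, d \in rim -> d \in S -> d \in porbit s x -> d \in porbit vertS x.
suff : P z by rewrite /P zS.
move: z zx {zS}; apply: porbit_ind => [|y yx]; first by rewrite /P xS porbit_id.
have sx : s y \in porbit s x by rewrite porbit_step.
rewrite /P; case: ifP => yS; case: ifP => sS.
- by move=> yv; have := porbit_step vertS x y; rewrite vertSE yS sS yv => ->.
- move=> yv d dC dS dx.
  have sC : s y \in rim by move: (region_step y); rewrite yS sS; case: (_ \in rim).
  have dsy : d \in porbit s (s y).
    by move: sx; rewrite -eq_porbit_mem => /eqP ->.
  case: (b_uniq sC dC dsy) => dE; first by rewrite dE sS in dS.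
  by have := porbit_step vertS x y; rewrite vertSE yS sS yv -dE => ->.
- move=> h; apply: h => //.
  by move: (region_step y); rewrite yS sS; case: (_ \in rim).
- by [].
Qed.

(** The product of faceS and aS is also the product of vertS and tau. The cycles of the
  first three are known, so the sign of tau is an Euler characteristic modulo 2: faces,
  inner edges and vertices of S. *)
Lemma odd_boundary_walk :
  odd_perm tau = odd #|porbit (s * a) @: S|
    (+) odd #|[set x in S | (x \notin rim) && col x]| (+) odd #|porbit s @: S|.
Proof.
have sig1 : odd_perm vertS = odd #|S| (+) odd #|porbit s @: S|.
  rewrite (@odd_perm_on _ _ S); last by move=> x xS; rewrite vertSE (negbTE xS).
  congr (_ (+) odd _).
  rewrite (_ : porbit vertS @: S = (fun O => O :&: S) @: (porbit s @: S)).
    apply: card_in_imset => _ _ /imsetP[x xS ->] /imsetP[y yS ->] E.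
    have : x \in porbit s x :&: S by rewrite in_setI porbit_id.
    by rewrite E in_setI -eq_porbit_mem => /andP[/eqP ->].
  rewrite -imset_comp; apply: eq_in_imset => x xS /=; exact: porbit_vertS.
have sig2 : odd_perm faceS = odd #|S| (+) odd #|porbit (s * a) @: S|.
  rewrite (@odd_perm_on _ _ S); last by move=> x xS; rewrite (restrE face_stable) (negbTE xS).
  by congr (_ (+) odd _); congr #|pred_of_set _|; apply: eq_in_imset; exact: porbit_faceS.
have sig3 : odd_perm aS = odd #|[set x in S | (x \notin rim) && col x]|.
  have fE x : aS x = if (x \in S) && (x \notin rim) then a x else x.
    by rewrite permE /flipS rimE; case: (x \in S) => //=; case: (a x \in S).
  apply: odd_involution => x.
  - rewrite in_set => /and3P[xS xC xc].
    by rewrite in_set fE xS xC /= acol xc !andbF.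
  - by move=> _; rewrite !permE flipS_K.
  - rewrite fE in_set; case xS: (x \in S) => //=; last by rewrite eqxx.
    case: (boolP (x \in rim)) => //= xC; first by rewrite eqxx.
    move=> xc _; rewrite in_set rim_a acol xc xC andbT.
    by move: xC; rewrite rimE xS; case: (a x \in S).
have -> : odd_perm tau = odd_perm (faceS * aS) (+) odd_perm vertS.
  by rewrite /vertS (odd_permM (_ * _)) odd_permV addKb.
rewrite odd_permM sig1 sig2 sig3.
by case: (odd #|S|); do 3!case: (odd _).
Qed.
End Surface.

(** * Homology of planar maps modulo 2 *)

Local Close Scope group_scope.
Local Open Scope ring_scope.

Definition F2b (b : bool) : 'F_2 := b%:R.

Lemma F2bD b c : F2b (b (+) c) = F2b b + F2b c.
Proof. by apply/val_inj; case: b; case: c. Qed.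

Lemma F2b_inj : injective F2b.
Proof. by case; case. Qed.

Lemma F2bK x : F2b (x == 1) = x.
Proof. by apply/val_inj; case: x => [[|[|]]]. Qed.

Lemma F2b_sum (I : finType) (P : pred I) (f : I -> bool) :
  F2b (\big[addb/false]_(i | P i) f i) = \sum_(i | P i) F2b (f i).
Proof. exact: (big_morph _ F2bD). Qed.

Section Homology.
Variables (E : finType) (s a : {perm E * bool}).
Let T : finType := (E * bool)%type.
Hypothesis aE : forall h : T, a h = flip h.

Section Incidence.
Variable p : {perm T}.

Lemma mem_porbits h : porbit p h \in porbits p.
Proof. exact: imset_f. Qed.

Definition orbit_index h : 'I_#|porbits p| := enum_rank_in (mem_porbits h) (porbit p h).

Definition orbit_at (i : 'I_#|porbits p|) : {set T} := enum_val i.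

Lemma orbit_at_index h : orbit_at (orbit_index h) = porbit p h.
Proof. by rewrite /orbit_at enum_rankK_in ?mem_porbits. Qed.

Lemma mem_orbit_at h i : (h \in orbit_at i) = (i == orbit_index h).
Proof.
apply/idP/eqP => [|->]; last by rewrite orbit_at_index porbit_id.
have /imsetP[h' _ E'] := enum_valP i; rewrite /orbit_at E' -eq_porbit_mem => /eqP E2.
by apply: enum_val_inj; rewrite E' -E2 -orbit_at_index.
Qed.

Lemma orbit_index_surj i : exists h, i = orbit_index h.
Proof.
have /imsetP[h _ E'] := enum_valP i; exists h; apply/eqP.
by rewrite -mem_orbit_at /orbit_at E' porbit_id.
Qed.

Lemma orbit_index_perm h : orbit_index (p h) = orbit_index h.
Proof. by apply/eqP; rewrite -mem_orbit_at orbit_at_index porbit_sym -{1}[p]expg1 mem_porbit. Qed.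

(** For the face permutation this is the boundary map from faces to edges, for the
  rotation the coboundary map from vertices to edges. *)
Definition incidence : 'M['F_2]_(#|porbits p|, #|E|) :=
  \matrix_(i, j) \sum_(b : bool) F2b ((enum_val j, b) \in orbit_at i).

Lemma mul_incidence (x : 'rV['F_2]_#|porbits p|) j :
  (x *m incidence) 0 j = \sum_(b : bool) x 0 (orbit_index (enum_val j, b)).
Proof.
rewrite mxE; under eq_bigr => i _ do rewrite mxE mulr_sumr.
rewrite exchange_big; apply: eq_bigr => b _.
rewrite (bigD1 (orbit_index (enum_val j, b))) //= mem_orbit_at eqxx mulr1 big1 ?addr0 //.
by move=> i /negbTE ni; rewrite mem_orbit_at ni mulr0.
Qed.

Lemma F2_addr0 (x y : 'F_2) : x + y = 0 -> x = y.
Proof. by case: x y => [[|[|]]//= ?] [[|[|]]//= ?] /(congr1 val) //= _; apply/val_inj. Qed.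

(* Both the rotation and the face permutation generate the components of the map
  together with a. *)
Hypothesis p_gen : forall f : T -> 'F_2, (forall h, f (p h) = f h) ->
  (forall h, f (a h) = f h) -> forall h, f (s h) = f h.

Let Gp : {group {perm T}} := <<[set s; a]>>%G.
Let comps := [set orbit 'P Gp h | h : T].

Lemma constant_on_component (f : T -> 'F_2) :
  (forall h, f (s h) = f h) -> (forall h, f (a h) = f h) ->
  forall h h', h' \in orbit 'P Gp h -> f h' = f h.
Proof.
move=> fs fa h h' /orbitP[g gG <-] /=; rewrite apermE.
pose K := [set g : {perm T} | [forall x, f (g x) == f x]].
have gK : group_set K.
  apply/group_setP; split; first by rewrite inE; apply/forallP=> x; rewrite perm1.
  move=> g1 g2; rewrite !inE => /forallP h1 /forallP h2; apply/forallP=> x.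
  by rewrite permM (eqP (h2 _)) h1.
have : <<[set s; a]>>%g \subset (Group gK).
  rewrite gen_subG; apply/subsetP=> g'; rewrite !inE => /orP[] /eqP ->.
    by apply/forallP=> x; rewrite fs.
  by apply/forallP=> x; rewrite fa.
by move=> /subsetP/(_ _ gG); rewrite inE => /forallP/(_ h)/eqP.
Qed.

(** A vector of the kernel is constant along the orbits of p and across each edge, hence
  on each component of the map. *)
Lemma rank_incidence : (#|porbits p| <= \rank incidence + #|comps|)%N.
Proof.
rewrite -leq_subLR -mxrank_ker.
pose P : 'M['F_2]_(#|comps|, #|porbits p|) :=
  \matrix_(j, i) (if [pick h in orbit_at i] is Some h then F2b (h \in (enum_val j : {set T})) else 0).
suff: (kermx incidence <= P)%MS.
  by move=> /mxrankS /leq_trans; apply; exact: rank_leq_row.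
apply/row_subP=> r; set x := row r _.
have xK : x *m incidence = 0 by apply/sub_kermxP; exact: row_sub.
pose f h := x 0 (orbit_index h).
have fp h : f (p h) = f h by rewrite /f orbit_index_perm.
have fa h : f (a h) = f h.
  have := mul_incidence x (enum_rank h.1); rewrite xK mxE enum_rankK.
  rewrite big_bool /= aE /f => /esym/F2_addr0 E'.
  by case: h E' => e [] /= ->.
have fs := p_gen fp fa.
have fc := constant_on_component fs fa.
apply/submxP; exists (\row_j (if [pick h in (enum_val j : {set T})] is Some h then f h else 0)).
apply/rowP=> i; rewrite [RHS]mxE.
under eq_bigr => j _ do rewrite !mxE.
case: (pickP (fun h => h \in orbit_at i)) => [h|no]; last first.
  by have [h hi] := orbit_index_surj i; have := no h; rewrite /= mem_orbit_at hi eqxx.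
rewrite mem_orbit_at => /eqP hi.
have hc : orbit 'P Gp h \in comps by apply: imset_f.
rewrite (bigD1 (enum_rank_in hc (orbit 'P Gp h))) //= big1 ?addr0 => [|j nj].
  rewrite enum_rankK_in // orbit_refl mulr1.
  by case: pickP => [h' /fc ->|/(_ h)]; rewrite ?orbit_refl // /f hi.
rewrite (_ : (h \in _) = false) ?mulr0 //.
apply: contraNF nj => hj; apply/eqP/enum_val_inj; rewrite enum_rankK_in //.
have /imsetP[h' _ E'] := enum_valP j; rewrite E' in hj *.
by apply/esym/eqP; rewrite orbit_eq_mem.
Qed.

End Incidence.

Let phi := (s * a)%g.
Let comps := [set orbit 'P <<[set s; a]>>%g h | h : T].

Hypothesis euler : (#|porbits s| + #|porbits phi| = #|porbits a| + 2 * #|comps|)%N.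

Lemma card_porbits_flip : #|porbits a| = #|E|.
Proof.
have aoE e b : porbit a (e, b) = [set h | h.1 == e].
  apply/setP=> h; rewrite inE; apply/idP/idP.
    apply: (@porbit_ind _ a (fun h => h.1 == e)) => //= y _.
    by rewrite aE.
  case: h => e' b' /= /eqP ->; have [->|nb] := eqVneq b' b; first exact: porbit_id.
  have -> : (e, b') = (a ^+ 1)%g (e, b) by rewrite expg1 aE /flip /=; case: b b' nb => [] [].
  by rewrite mem_porbit.
have -> : porbits a = [set [set h : T | h.1 == e] | e : E].
  apply/setP=> O; apply/imsetP/imsetP=> [[[e b] _ ->]|[e _ ->]].
    by exists e; rewrite ?aoE.
  by exists (e, true); rewrite ?aoE.
rewrite card_imset // => e e' /setP/(_ (e, true)); rewrite !inE eqxx /=.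
by move=> /esym/eqP.
Qed.

Lemma aK h : a (a h) = h.
Proof. by rewrite !aE flipK. Qed.

Lemma sum_edges (f : E -> 'F_2) : \sum_(j < #|E|) f (enum_val j) = \sum_e f e.
Proof.
rewrite (reindex (@enum_rank E)) /=; last exact/onW_bij/enum_rank_bij.
by apply: eq_bigr => e _; rewrite enum_rankK.
Qed.

Lemma sum_half_edges (f : T -> 'F_2) : \sum_e \sum_b f (e, b) = \sum_h f h.
Proof. by rewrite pair_bigA; apply: eq_bigr => -[]. Qed.

Lemma F2_odd n : F2b (odd n) = n%:R.
Proof.
elim: n => [|n IH]; first exact/val_inj.
by rewrite oddS -addbT F2bD IH -[RHS]natr1.
Qed.

Lemma F2_card (P : {set T}) : F2b (odd #|P|) = \sum_h F2b (h \in P).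
Proof.
rewrite F2_odd -sum1_card natr_sum [LHS]big_mkcond /=.
by apply: eq_bigr => h _; case: (_ \in _).
Qed.

(** The product of the two incidence matrices vanishes because a face arrives at a
  vertex as often as it leaves it. By Euler's formula the lower bounds of rank_incidence
  for the two ranks leave no room for homology. *)
Lemma incidence_exact (c : 'rV['F_2]_#|E|) :
  c *m (incidence s)^T = 0 -> exists x, c = x *m incidence phi.
Proof.
move=> c0; apply/submxP.
have r1 : (#|porbits s| <= \rank (incidence s) + #|comps|)%N by apply: rank_incidence.
have r2 : (#|porbits phi| <= \rank (incidence phi) + #|comps|)%N.
  by apply: rank_incidence => f fp fa h; rewrite -fa -(fp h) permM.
have sub : (incidence phi <= kermx (incidence s)^T)%MS.
  apply/sub_kermxP/matrixP=> i k; rewrite mxE [RHS]mxE.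
  under eq_bigr => j _ do rewrite !mxE.
  rewrite (sum_edges (fun e => (\sum_b F2b ((e, b) \in orbit_at i)) * (\sum_b F2b ((e, b) \in orbit_at k)))).
  transitivity (\sum_(h : T) (F2b (h \in orbit_at i) * F2b (h \in orbit_at k) +
                              F2b (h \in orbit_at i) * F2b (a h \in orbit_at k))).
    rewrite -(sum_half_edges (fun h => F2b (h \in orbit_at i) * F2b (h \in orbit_at k) +
                              F2b (h \in orbit_at i) * F2b (a h \in orbit_at k))).
    apply: eq_bigr => e _; rewrite !big_bool !aE /= /flip /=.
    by rewrite -!mulrDr mulrDl [in X in _ = _ + X]addrC.
  rewrite big_split /= [X in _ + X](reindex_inj (@perm_inj _ phi)) /=.
  rewrite [X in _ + X](eq_bigr (fun h => F2b (h \in orbit_at i) * F2b (h \in orbit_at k))).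
    by set z := \sum_(_ | _) _; case: z => [[|[|]]] //= ?; apply/val_inj.
  move=> h _; rewrite !mem_orbit_at orbit_index_perm permM aK; congr (_ * F2b _).
  by rewrite orbit_index_perm.
have : (kermx (incidence s)^T <= incidence phi)%MS.
  rewrite -(geq_leqif (mxrank_leqif_sup sub)) mxrank_ker mxrank_tr.
  move: euler; rewrite card_porbits_flip; lia.
by apply: submx_trans; apply/sub_kermxP.
Qed.

(** The first homology of a planar map vanishes. *)
Lemma even_edges_bound (C : {set E}) :
  (forall h, ~~ odd #|[set h' in porbit s h | h'.1 \in C]|) ->
  exists S : {set T}, (forall h, (a (s h) \in S) = (h \in S)) /\
    forall h, (h.1 \in C) = (h \in S) (+) (a h \in S).
Proof.
move=> evC; have [|x cx] := @incidence_exact (\row_j F2b (enum_val j \in C)).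
  apply/rowP=> k; rewrite mxE [RHS]mxE.
  under eq_bigr => j _ do rewrite !mxE.
  rewrite (sum_edges (fun e => F2b (e \in C) * (\sum_b F2b ((e, b) \in orbit_at k)))).
  have [h hk] := orbit_index_surj k.
  transitivity (F2b (odd #|[set h' in porbit s h | h'.1 \in C]|)); last first.
    by rewrite (negbTE (evC h)).
  rewrite F2_card -sum_half_edges; apply: eq_bigr => e _.
  rewrite mulr_sumr; apply: eq_bigr => b _.
  rewrite inE hk orbit_at_index /=; case: (_ \in porbit s h); case: (e \in C); exact/val_inj.
exists [set h | x 0 (orbit_index phi h) == 1]; split=> h; rewrite !inE.
  by rewrite -permM orbit_index_perm.
apply: F2b_inj; rewrite F2bD !F2bK.
have /rowP/(_ (enum_rank h.1)) := cx; rewrite mul_incidence !mxE enum_rankK => ->.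
by rewrite big_bool aE /=; case: h => e [] //=; rewrite addrC.
Qed.

(** Linear duality: a functional that vanishes on the kernel of the boundary map factors
  through this map. *)
Lemma coboundary_exists (kappa : {set T} -> bool) :
  (forall S : {set T}, (forall h, (a (s h) \in S) = (h \in S)) ->
     (forall h, (a h \in S) = (h \in S)) ->
     \big[addb/false]_(O in porbit phi @: S) kappa O = false) ->
  exists eps : E -> bool, forall S : {set T},
    (forall h, (a (s h) \in S) = (h \in S)) ->
    \big[addb/false]_(e | ((e, true) \in S) (+) ((e, false) \in S)) eps e
    = \big[addb/false]_(O in porbit phi @: S) kappa O.
Proof.
move=> kappa0.
pose k : 'cV['F_2]_#|porbits phi| := \col_i F2b (kappa (orbit_at i)).
pose mem_S (x : 'rV['F_2]_#|porbits phi|) := [set h | x 0 (orbit_index phi h) == 1].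
have xk (x : 'rV['F_2]_#|porbits phi|) :
    (x *m k) 0 0 = F2b (\big[addb/false]_(O in porbit phi @: mem_S x) kappa O).
  have -> : porbit phi @: mem_S x = [set orbit_at i | i in [set i | x 0 i == 1]].
    apply/setP=> O; apply/imsetP/imsetP => [[h]|[i]].
      by rewrite inE => xh ->; exists (orbit_index phi h); rewrite ?inE ?orbit_at_index.
    by have [h ->] := orbit_index_surj i; rewrite inE => xh ->; exists h; rewrite ?inE ?orbit_at_index.
  rewrite mxE big_imset /=; last by move=> i j _ _; exact: enum_val_inj.
  rewrite F2b_sum [RHS]big_mkcond; apply: eq_bigr => i _.
  rewrite inE -{1}[x 0 i]F2bK mxE; case: (_ == 1); first by rewrite mul1r.
  by rewrite mul0r.
have [y ky] : exists y, k = incidence phi *m y.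
  suff /submxP[D kD] : (k^T <= (incidence phi)^T)%MS.
    by exists D^T; apply: trmx_inj; rewrite trmx_mul trmxK.
  rewrite submxE; set Z := cokermx _; apply/eqP/trmx_inj; rewrite trmx_mul trmxK trmx0.
  have ZK : Z^T *m incidence phi = 0.
    by apply: trmx_inj; rewrite trmx_mul trmxK mulmx_coker trmx0.
  apply/row_matrixP=> i; rewrite row_mul row0; apply/rowP=> j.
  have -> : j = 0 by apply/val_inj; case: j => [[]].
  rewrite xk kappa0 ?mxE // => h; rewrite !inE; first by rewrite -permM orbit_index_perm.
  have : (row i Z^T *m incidence phi) 0 (enum_rank h.1) = 0 by rewrite -row_mul ZK row0 mxE.
  rewrite mul_incidence big_bool enum_rankK aE /= => /F2_addr0.
  by case: h => e [] /= ->.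
exists (fun e => y (enum_rank e) 0 == 1) => S phiS.
pose x : 'rV['F_2]_#|porbits phi| := \row_i F2b (orbit_at i \subset S).
have xS h : x 0 (orbit_index phi h) = F2b (h \in S).
  rewrite mxE orbit_at_index; congr F2b; apply/subsetP/idP => [|hS]; first by apply; exact: porbit_id.
  by apply: porbit_ind => // h' _; rewrite permM phiS.
have SE : S = mem_S x by apply/setP=> h; rewrite inE xS; case: (h \in S).
apply: F2b_inj; rewrite F2b_sum [in RHS]SE -xk ky mulmxA [RHS]mxE.
rewrite [RHS](eq_bigr (fun j => F2b (((enum_val j, true) \in S) (+) ((enum_val j, false) \in S)) *
    y (enum_rank (enum_val j)) 0)); last first.
  by move=> j _; rewrite mul_incidence big_bool !xS F2bD enum_valK.
rewrite (sum_edges (fun e => F2b (((e, true) \in S) (+) ((e, false) \in S)) * y (enum_rank e) 0)).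
rewrite [LHS]big_mkcond; apply: eq_bigr => e _; rewrite F2bK.
by case: (_ (+) _); rewrite ?mul1r ?mul0r.
Qed.
End Homology.

(** * Almost perfect matchings *)

Local Close Scope ring_scope.
Local Open Scope group_scope.

Section Graph.
Variables (n : nat) (G : bgraph n).
Local Notation H := (half_edge G).
Local Notation V := (ivert G + 'I_n)%type.
Implicit Types (h : H) (P : {set edge G}).

Lemma vert_black h : black G (vert h) = h.2.
Proof. by case: h => e b; exact: black_vert. Qed.

Lemma vert_bhalf i : vert (bhalf G i) = inr i.
Proof. by apply/eqP; rewrite bhalfP. Qed.

Lemma vert_inr h i : vert h = inr i -> h = bhalf G i.
Proof. by move/eqP; rewrite bhalfP => /eqP. Qed.

Lemma bhalf_inj : injective (bhalf G).
Proof. by move=> i j E; have := vert_bhalf i; rewrite E vert_bhalf => -[]. Qed.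

Lemma bhalf2 i : (bhalf G i).2 = black G (inr i).
Proof. by rewrite -vert_black vert_bhalf. Qed.

Lemma incidentE e v : incident e v = (vert (e, black G v) == v).
Proof.
rewrite /incident; case Eb: (black G v).
  by rewrite orbC; case: eqP => // E; move: Eb; rewrite -E black_vert.
by case: eqP => // E; move: Eb; rewrite -E black_vert.
Qed.

Definition used P i := (bhalf G i).1 \in P.

Lemma matching_deg_inr P i : matching_deg P (inr i) = used P i.
Proof.
rewrite /matching_deg /used; transitivity #|[set e in P | e == (bhalf G i).1]|.
  apply: eq_card => e; rewrite !inE incidentE bhalfP -bhalf2.
  by case: (bhalf G i) => e' b; rewrite xpair_eqE eqxx andbT.
case: (boolP (_ \in P)) => uP.
  rewrite (_ : [set _ in _ | _] = [set (bhalf G i).1]) ?cards1 //.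
  by apply/setP=> e; rewrite !inE; case: eqP => [->|]; rewrite ?andbF ?andbT.
by apply/eqP; rewrite cards_eq0; apply/eqP/setP=> e; rewrite !inE; case: eqP => [->|];
  rewrite ?andbF ?andbT //; apply/negbTE.
Qed.

Lemma mem_boundary P i : (i \in matching_boundary P) = (used P i == black G (inr i)).
Proof. by rewrite inE matching_deg_inr; case: (black _ _); case: (used _ _). Qed.

Lemma almost_perfectP P :
  reflect (forall v, exists2 h, vert h = inl v /\ h.1 \in P &
      forall h', vert h' = inl v -> h'.1 \in P -> h' = h) (almost_perfect P).
Proof.
have rim : [forall i, matching_deg P (inr i) <= 1].
  by apply/forallP=> i; rewrite matching_deg_inr; case: used.
rewrite /almost_perfect rim andbT; apply: (iffP forallP) => h v.
  have /cards1P[e Pe] := h v; exists (e, black G (inl v)).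
    have : e \in [set e] by rewrite inE.
    by rewrite -Pe inE incidentE => /andP[-> /eqP ->].
  move=> h' vh' h'P; have : h'.1 \in [set e].
    rewrite -Pe inE h'P incidentE -vh' vert_black -surjective_pairing.
    by rewrite eqxx.
  rewrite inE => /eqP <-; rewrite -vh' vert_black; exact: surjective_pairing.
have [g [vg gP] gU] := h v; apply/cards1P; exists g.1; apply/setP=> e.
rewrite !inE incidentE; apply/andP/eqP => [[eP /eqP ve]|->].
  by rewrite -(gU (e, black G (inl v))).
by rewrite gP -vg vert_black -surjective_pairing eqxx.
Qed.

(** At an unused boundary vertex the value is h itself. *)
Definition matched_half P h := odflt h [pick h' | (vert h' == vert h) && (h'.1 \in P)].

Section Md.
Variable P : {set edge G}.
Hypothesis AP : almost_perfect P.

Lemma unique_at h h' : vert h = vert h' -> h.1 \in P -> h'.1 \in P -> h = h'.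
Proof.
case E: (vert h) => [v|i] /esym E'.
  by move=> hP h'P; have /almost_perfectP/(_ v)[g _ gU] := AP; rewrite (gU h E hP) (gU h' E' h'P).
by rewrite (vert_inr E) (vert_inr E').
Qed.

Lemma vert_matched_half h : vert (matched_half P h) = vert h.
Proof. by rewrite /matched_half; case: pickP => //= h' /andP[/eqP]. Qed.

Lemma matched_half_in h v : vert h = inl v -> (matched_half P h).1 \in P.
Proof.
move=> hv; rewrite /matched_half; case: pickP => [h' /andP[] //|no].
have [g [vg gP] _] := almost_perfectP _ AP v.
by have := no g; rewrite vg hv eqxx gP.
Qed.

Lemma matched_half_eq h h' : vert h' = vert h -> h'.1 \in P -> matched_half P h = h'.
Proof.
move=> vh h'P; rewrite /matched_half; case: pickP => [g /= /andP[/eqP vg gP]|/(_ h')].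
  by apply: unique_at; rewrite ?vg ?vh.
by rewrite vh eqxx h'P.
Qed.

End Md.

(** An unused boundary vertex is its own mate. A white one then stands both for its row
  and for its column. *)
Definition mate P (u : V) : V :=
  if [pick h | (vert h == u) && (h.1 \in P)] is Some h then vert (flip h) else u.

Lemma mateE P h : almost_perfect P -> h.1 \in P -> mate P (vert h) = vert (flip h).
Proof.
move=> AP hP; rewrite /mate; case: pickP => [g /andP[/eqP vg gP]|/(_ h)].
  by rewrite (unique_at AP vg gP hP).
by rewrite eqxx hP.
Qed.

Lemma mate_unused P i : ~~ used P i -> mate P (inr i) = inr i.
Proof.
move=> uP; rewrite /mate; case: pickP => // h /andP[/eqP/vert_inr ->].
by rewrite -/(used P i) (negbTE uP).
Qed.

Lemma mateK P : almost_perfect P -> involutive (mate P).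
Proof.
move=> AP u; rewrite {2}/mate; case: pickP => [h /andP[/eqP <- hP]|no].
  by rewrite mateE // flipK.
by rewrite /mate; case: pickP => // h; rewrite no.
Qed.

End Graph.

(** * The symmetric difference of two matchings in the map *)

Section Embedding.
Variables (n : nat) (G : bgraph n) (D : disk_embedding G).
Local Notation H := (half_edge G).

(** None stands for the point at infinity, to which all boundary vertices are shrunk. *)
Definition map_vertex (h : H) : option (ivert G) :=
  if vert h is inl v then Some v else None.

Lemma map_vertex_int h v : (map_vertex h = Some v) <-> (vert h = inl v).
Proof. by rewrite /map_vertex; case: (vert h) => [w|i]; split=> // -[->]. Qed.

Lemma map_vertex_bhalf i : map_vertex (bhalf G i) = None.
Proof. by rewrite /map_vertex vert_bhalf. Qed.

Lemma map_vertex_None h : map_vertex h = None -> exists i, h = bhalf G i.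
Proof. by rewrite /map_vertex; case E: (vert h) => [//|i] _; exists i; exact: vert_inr. Qed.

Lemma iter_ordS (i : 'I_n) k : val (iter k (@ordS n) i) = (i + k) %% n.
Proof.
elim: k => [|k IH]; first by rewrite addn0 modn_small.
by rewrite iterS /= IH -addn1 modnDml addn1 addnS.
Qed.

Lemma porbit_rot h h' : (h' \in porbit (Defs.rot D) h) = (map_vertex h' == map_vertex h).
Proof.
case E: (map_vertex h) => [v|].
  have hv := (map_vertex_int h v).1 E.
  by rewrite (rot_int D hv) inE; apply/eqP/eqP => /map_vertex_int.
have [i ->] := map_vertex_None E; apply/idP/eqP => [|/map_vertex_None[j ->]].
  apply: (@porbit_ind _ _ (fun y => map_vertex y = None)); first exact: map_vertex_bhalf.
  by move=> y _ /map_vertex_None[j ->]; rewrite rot_boundary map_vertex_bhalf.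
have -> : j = iter (n - i + j) (@ordS n) i.
  apply: val_inj; rewrite iter_ordS addnA subnKC; last exact/ltnW.
  by rewrite modnDl modn_small.
elim: (n - i + j) => [|k IH]; first exact: porbit_id.
by rewrite iterS -(rot_boundary D) porbit_step.
Qed.

Lemma flip_permE h : flip_perm G h = flip h.
Proof. by rewrite permE. Qed.

End Embedding.

Section Pair.
Variables (n : nat) (G : bgraph n).
Local Notation H := (half_edge G).
Variables P Q : {set edge G}.
Hypotheses (AP : almost_perfect P) (AQ : almost_perfect Q).

Definition symdiff (h : H) := (h.1 \in P) (+) (h.1 \in Q).

Lemma symdiff_flip h : symdiff (flip h) = symdiff h.
Proof. by []. Qed.

(** The other half-edge of the symmetric difference at the same vertex. A boundary
  half-edge is alone at its vertex and stays fixed. *)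
Definition switch h :=
  if symdiff h then (if h.1 \in P then matched_half Q h else matched_half P h) else h.

Lemma vert_switch h : vert (switch h) = vert h.
Proof. by rewrite /switch; case: ifP => // _; case: ifP => _; rewrite vert_matched_half. Qed.

Lemma switch_bhalf i : switch (bhalf G i) = bhalf G i.
Proof. by apply: vert_inr; rewrite vert_switch vert_bhalf. Qed.

Lemma switch_int h v : vert h = inl v -> symdiff h ->
  [/\ symdiff (switch h), ((switch h).1 \in P) = (h.1 \notin P) & switch h != h].
Proof.
move=> hv hC; rewrite /switch hC; move: hC; rewrite /symdiff.
case hP: (h.1 \in P); case hQ: (h.1 \in Q) => //= _.
  have gQ := matched_half_in AQ hv; set g := matched_half Q h in gQ *.
  have gP : g.1 \in P = false.
    apply/negP=> gP; have E : h = g by apply: (unique_at AP); rewrite ?vert_matched_half.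
    by rewrite E gQ in hQ.
  by rewrite gQ gP; split=> //; apply: contraFneq gP => ->.
have gP := matched_half_in AP hv; set g := matched_half P h in gP *.
have gQ : g.1 \in Q = false.
  apply/negP=> gQ; have E : h = g by apply: (unique_at AQ); rewrite ?vert_matched_half.
  by rewrite E gP in hP.
by rewrite gQ gP; split=> //; apply: contraTneq gP => ->; rewrite hP.
Qed.

Lemma switch_symdiff h : symdiff h -> symdiff (switch h).
Proof.
case E: (vert h) => [v|i] hC; first by have [] := switch_int E hC.
by rewrite (vert_inr E) switch_bhalf -(vert_inr E).
Qed.

Lemma switch_uniq h h' : symdiff h -> symdiff h' -> vert h' = vert h -> h' = h \/ h' = switch h.
Proof.
move=> hC; rewrite /switch hC; move: hC; rewrite /symdiff.
case hP: (h.1 \in P); case hQ: (h.1 \in Q) => //= _;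
  case hP': (h'.1 \in P); case hQ': (h'.1 \in Q) => //= _ E.
- by left; apply: (unique_at AP).
- by right; rewrite (matched_half_eq AQ E).
- by right; rewrite (matched_half_eq AP E).
- by left; apply: (unique_at AQ).
Qed.

Lemma switchK : involutive switch.
Proof.
move=> h; case hC: (symdiff h); last by rewrite /switch hC hC.
case E: (vert h) => [v|i]; last by rewrite (vert_inr E) !switch_bhalf.
have [gC gP gh] := switch_int E hC.
have E' : vert (switch h) = inl v by rewrite vert_switch.
have [kC _ kg] := switch_int E' gC.
have [|//|E''] := switch_uniq hC kC; first by rewrite !vert_switch.
by rewrite E'' eqxx in kg.
Qed.

Definition switch_perm : {perm H} := perm (inv_inj switchK).

(** Orienting the edges of P from white to black and those of Q from black to white,
  the half-edges that are tails. *)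
Definition tail (h : H) := (h.1 \in P) (+) h.2.

Lemma tail_flip h : tail (flip h) = ~~ tail h.
Proof. by rewrite /tail /= addbN. Qed.

Lemma tail_switch h v : vert h = inl v -> symdiff h -> tail (switch h) = ~~ tail h.
Proof.
move=> hv hC; have [_ gP _] := switch_int hv hC.
by rewrite /tail gP -!vert_black vert_switch addNb.
Qed.

(** As a consequence, the paths of the symmetric difference lead from I(Q) to I(P). *)
Lemma tail_bhalf i : tail (bhalf G i) = (i \notin matching_boundary P).
Proof. by rewrite mem_boundary /tail -/(used P i) bhalf2 -addNb; case: used; case: black. Qed.

Lemma symdiff_bhalf i :
  symdiff (bhalf G i) = (i \in matching_boundary P) (+) (i \in matching_boundary Q).
Proof.
by rewrite !mem_boundary /symdiff -/(used P i) -/(used Q i); do 2!case: used; case: black.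
Qed.

End Pair.

(** * Parity counts in a region bounded by the symmetric difference *)

Section Parity.
Variable T : finType.
Implicit Types g : T -> bool.

Lemma odd_card_sum (A : {set T}) : odd #|A| = \big[addb/false]_x (x \in A).
Proof.
rewrite -sum1_card (big_morph odd oddD (_ : odd 0 = false)) // big_mkcond.
by apply: eq_bigr => x _; case: (_ \in _).
Qed.

(** p exchanges the two halves of g cut out by chi. *)
Lemma parity_paired (g chi : T -> bool) (p : {perm T}) :
  (forall x, g (p x) = g x) -> (forall x, g x -> chi (p x) = ~~ chi x) ->
  \big[addb/false]_x g x = false.
Proof.
move=> gp chip.
transitivity (\big[addb/false]_x (g x && chi x (+) g x && ~~ chi x)).
  by apply: eq_bigr => x _; case: (g x); case: (chi x).
rewrite big_split /= [X in X (+) _](reindex_inj (@perm_inj _ p)) /=.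
rewrite (eq_bigr (fun x => g x && ~~ chi x)) ?addbb // => x _.
by rewrite gp; case gx: (g x) => //=; rewrite chip.
Qed.

End Parity.

(** This half-edge marks the face between the last and the first boundary vertex, where
  the linear order of the boundary breaks the cyclic one. *)
Definition last_half n (G : bgraph n) (h : half_edge G) : bool :=
  [exists i : 'I_n, (i.+1 == n) && (h == bhalf G i)].

Lemma last_halfP n (G : bgraph n) (h : half_edge G) :
  last_half h -> exists2 i : 'I_n, h = bhalf G i & i.+1 = n.
Proof. by move=> /existsP[i /andP[/eqP ? /eqP ?]]; exists i. Qed.

Section Closed.
Variables (n : nat) (G : bgraph n) (D : disk_embedding G).
Local Notation H := (half_edge G).
Local Notation V := (ivert G + 'I_n)%type.
Variables P Q : {set edge G}.
Hypotheses (AP : almost_perfect P) (AQ : almost_perfect Q).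
Local Notation symdiff := (symdiff P Q).
Local Notation tail := (tail P).

(* The symmetric difference is seen as a union of disjoint cycles of the map, possibly
  one through the point at infinity; b exchanges the two half-edges of a cycle at a vertex
  and respects the orientation of the cycles. *)
Variable b : {perm H}.
Hypothesis b_symdiff : forall h, symdiff h -> symdiff (b h).
Hypothesis b_neq : forall h, symdiff h -> b h != h.
Hypothesis b_vertex : forall h, symdiff h -> map_vertex (b h) = map_vertex h.
Hypothesis b_uniq : forall h h', symdiff h -> symdiff h' ->
  map_vertex h' = map_vertex h -> h' = h \/ h' = b h.
Hypothesis b_tail : forall h, symdiff h -> tail (b h) = ~~ tail h.

Definition tails := [set h | symdiff h] :&: [set h | tail h].

Lemma b_K h : symdiff h -> b (b h) = h.
Proof.
move=> hC; have [E|<-] := b_uniq (b_symdiff hC) hC (esym (b_vertex hC)) => //.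
by have := b_neq hC; rewrite -E eqxx.
Qed.

(** One half-edge for each white interior vertex of the symmetric difference. *)
Definition white_inner_tails :=
  [set h | [&& symdiff h, tail h, ~~ h.2 & map_vertex h != None]].

Section Region.
Variable S : {set H}.
Hypothesis S_face : forall h, (flip (Defs.rot D h) \in S) = (h \in S).
Hypothesis S_bd : forall h, symdiff h = (h \in S) (+) (flip h \in S).

Lemma region_paired h : symdiff h -> (b h \in S) = (h \notin S).
Proof.
have rimE' : rim (flip_perm G) S = [set h | symdiff h].
  by apply/setP=> h'; rewrite rimE inE S_bd flip_permE.
move=> hC; apply: (@region_pairing _ (Defs.rot D) (flip_perm G) S _ b).
- by move=> x; rewrite flip_permE S_face.
- by move=> x y; rewrite rimE' !inE porbit_rot => xC yC /eqP; exact: b_uniq.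
- by rewrite rimE' inE.
Qed.

(** The cycles of the symmetric difference may be walked along the orientation tail or
  with S on one side. The directions may disagree on some cycles, but by odd_dihedral
  the sign is the same. *)
Lemma odd_tail_walk :
  odd_perm (restr_perm tails (flip_perm G * b)) =
  odd #|porbit (Defs.rot D * flip_perm G) @: S|
  (+) odd #|[set h in S | ~~ symdiff h && ~~ h.2]|
  (+) odd #|porbit (Defs.rot D) @: S|.
Proof.
have rimE' : rim (flip_perm G) S = [set h | symdiff h].
  by apply/setP=> h; rewrite rimE inE S_bd flip_permE.
rewrite -(@odd_dihedral _ _ _ [set h | symdiff h] S).
- rewrite -rimE' (@odd_boundary_walk _ (Defs.rot D) (flip_perm G) (fun h => ~~ h.2)).
  + by congr (_ (+) odd _ (+) _); apply: eq_card => h; rewrite !in_set flip_permE S_bd.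
  + by move=> x; rewrite !flip_permE flipK.
  + by move=> x; rewrite !flip_permE.
  + by move=> x; rewrite flip_permE S_face.
  + by move=> x; rewrite rimE' !inE; exact: b_symdiff.
  + by move=> x; rewrite rimE' !inE; exact: b_neq.
  + by move=> x; rewrite rimE' !inE porbit_rot => xC; rewrite b_vertex.
  + by move=> x y; rewrite rimE' !inE porbit_rot => xC yC /eqP; exact: b_uniq.
- by move=> h; rewrite !inE flip_permE => hC; rewrite symdiff_flip hC b_symdiff // flip_permE flipK b_K.
- move=> h; rewrite !inE flip_permE => hC; rewrite tail_flip b_tail // region_paired //.
  by move: hC; rewrite S_bd; case: (h \in S); case: (flip h \in S).
Qed.


Variable p0 : bool.
Hypothesis p0E : p0 = ~~ [exists i, symdiff (bhalf G i)].

Lemma region_constant h h' : (forall g, map_vertex g = map_vertex h -> ~~ symdiff g) ->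
  map_vertex h' = map_vertex h -> (h' \in S) = (h \in S).
Proof.
move=> noC /eqP; rewrite -(porbit_rot D) => hh'; apply/eqP; move: h' hh'.
apply: porbit_ind => // h'; rewrite porbit_rot => /eqP hv /eqP <-.
apply/eqP; rewrite -[RHS]S_face.
have : ~~ symdiff (Defs.rot D h') by apply: noC; apply/eqP; rewrite -(porbit_rot D) porbit_step porbit_rot hv.
by rewrite S_bd; case: (_ \in S); case: (_ \in S).
Qed.

(** Each vertex that touches S has one representative on the right: a half-edge of the
  symmetric difference; away from it, the half-edge matched by P; at the point at
  infinity, the last half-edge. *)
Lemma odd_vertices_touched :
  odd #|porbit (Defs.rot D) @: S| =
  odd #|[set h in S | symdiff h || (map_vertex h != None) && (h.1 \in P) || p0 && last_half h]|.
Proof.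
set R := [set h in S | _].
have rS h : h \in R -> h \in S by rewrite inE => /andP[].
rewrite (_ : porbit (Defs.rot D) @: S = porbit (Defs.rot D) @: R).
  rewrite card_in_imset // => h h' hR h'R /eqP; rewrite eq_porbit_mem porbit_rot => /eqP vh.
  have hS := rS _ hR; have hS' := rS _ h'R.
  move: hR h'R; rewrite !inE hS hS' /=.
  case hC: (symdiff h); case hC': (symdiff h') => /=.
  - move=> _ _; have [//|E] := b_uniq hC' hC vh.
    by move: hS; rewrite E region_paired // hS'.
  - move=> _ /orP[/andP[h'v h'P]|/andP[p0T h'l]].
      have h'Q : h'.1 \in Q by move: hC'; rewrite /symdiff h'P; case: (_ \in Q).
      case v: (map_vertex h') h'v vh => [w|//] _ vh.
      have /map_vertex_int hw := vh; have /map_vertex_int hw' := v.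
      move: (hC); rewrite /symdiff; case hP: (h.1 \in P) => /= hQ.
        by apply: (unique_at AP); rewrite ?hw ?hw'.
      by apply: (unique_at AQ); rewrite ?hw ?hw'.
    move: p0T; rewrite p0E => /existsPn no.
    have [i h'i _] := last_halfP h'l.
    have [j hj] : exists j, h = bhalf G j.
      by apply: map_vertex_None; rewrite vh h'i map_vertex_bhalf.
    by have := no j; rewrite -hj hC.
  - move=> /orP[/andP[hv hP]|/andP[p0T hl]] _.
      have hQ : h.1 \in Q by move: hC; rewrite /symdiff hP; case: (_ \in Q).
      case v: (map_vertex h') vh hv => [w|] vh; last by rewrite vh.
      have /map_vertex_int hw := vh; have /map_vertex_int hw' := v.
      move: (hC'); rewrite /symdiff; case hP': (h'.1 \in P) => /= hQ' _.
        by apply: (unique_at AP); rewrite ?hw ?hw'.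
      by apply: (unique_at AQ); rewrite ?hw ?hw'.
    move: p0T; rewrite p0E => /existsPn no.
    have [i hi _] := last_halfP hl.
    have [j hj] : exists j, h' = bhalf G j.
      by apply: map_vertex_None; rewrite -vh hi map_vertex_bhalf.
    by have := no j; rewrite -hj hC'.
  - case/orP=> [/andP[hv hP]|/andP[_ /last_halfP[i hi ni]]].
      case v: (map_vertex h) hv vh => [w|//] _ /esym v'.
      have /map_vertex_int hw := v; have /map_vertex_int hw' := v'.
      rewrite v' /= => /orP[h'P|/andP[_ /last_halfP[i h'i _]]].
        by apply: (unique_at AP); rewrite ?hw ?hw'.
      by rewrite h'i map_vertex_bhalf in v'.
    move: vh; rewrite hi map_vertex_bhalf => <- /= /andP[_ /last_halfP[j -> nj]].
    by congr bhalf; apply/val_inj/eqP; rewrite -eqSS /= ni nj.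
apply/setP=> O; apply/imsetP/imsetP => -[h hS ->]; last by exists h; rewrite ?rS.
suff [g gR gh] : exists2 g, g \in R & map_vertex g = map_vertex h.
  by exists g => //; apply/eqP; rewrite eq_porbit_mem porbit_rot gh.
case: (pickP (fun c => symdiff c && (map_vertex c == map_vertex h))) => [c /andP[cC /eqP ch]|noC].
  case cS: (c \in S); first by exists c; rewrite // inE cS cC.
  by exists (b c); rewrite ?b_vertex // inE region_paired // cS b_symdiff.
have noC' g : map_vertex g = map_vertex h -> ~~ symdiff g.
  by move=> gh; have := noC g; rewrite gh eqxx andbT => ->.
have inR g : map_vertex g = map_vertex h -> (map_vertex h != None) && (g.1 \in P) || p0 && last_half g ->
    g \in R.
  by move=> gh gR; rewrite inE (region_constant noC' gh) hS gh -orbA gR orbT.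
case v: (map_vertex h) => [w|].
  have [g [gw gP] _] := almost_perfectP _ AP w.
  have gv : map_vertex g = map_vertex h by rewrite v; apply/map_vertex_int.
  by exists g; rewrite -?v // inR // v gP.
have [i hi] := map_vertex_None v.
have ltn1 : n.-1 < n by rewrite prednK // (leq_ltn_trans _ (ltn_ord i)).
pose l := Ordinal ltn1; have gv : map_vertex (bhalf G l) = map_vertex h.
  by rewrite map_vertex_bhalf v.
exists (bhalf G l); last by rewrite map_vertex_bhalf.
apply: inR => //; rewrite v /= p0E; apply/andP; split.
  by apply/existsPn => j; apply: noC'; rewrite map_vertex_bhalf v.
by apply/existsP; exists l; rewrite eqxx andbT /= prednK // (leq_ltn_trans _ (ltn_ord i)).
Qed.

(** The matching P pairs the vertices inside S, up to those matched with the boundary,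
  and both ways of choosing one half-edge at each white vertex of the symmetric
  difference cancel. The surviving terms add over the faces of S or belong to the
  boundary. *)
Lemma odd_tail_walk_count :
  odd_perm (restr_perm tails (flip_perm G * b)) (+) odd #|white_inner_tails| =
  odd #|porbit (Defs.rot D * flip_perm G) @: S|
  (+) odd #|[set h in S | ~~ h.2 && (map_vertex h != None)]|
  (+) odd #|[set i | [&& bhalf G i \in S, ~~ symdiff (bhalf G i) & i \in matching_boundary P]]|
  (+) (p0 && odd #|[set h in S | last_half h]|)
  (+) odd #|[set i | symdiff (bhalf G i) && ~~ black G (inr i)]|.
Proof.
have b_stable h : symdiff (b h) = symdiff h.
  have st : stable b [set h | symdiff h] by move=> g; rewrite !inE => /b_symdiff.
  by have := stableP st h; rewrite !inE.
have b_color h : symdiff h -> map_vertex h != None -> (b h).2 = h.2.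
  move=> hC; case v: (map_vertex h) => [w|//] _.
  have v' := b_vertex hC; rewrite v in v'.
  by rewrite -!vert_black ((map_vertex_int _ _).1 v) ((map_vertex_int _ _).1 v').
pose int (h : H) := map_vertex h != None.
(* Of the two half-edges of the symmetric difference at a vertex, one is a tail and one
  lies in S. *)
have F1 : \big[addb/false]_h ([&& symdiff h, tail h, ~~ h.2 & int h]
    (+) [&& symdiff h, h \in S, ~~ h.2 & int h]) = false.
  rewrite -[RHS](@parity_paired _ (fun h => [&& symdiff h, ~~ h.2, int h & tail h (+) (h \in S)])
    (fun h => h \in S) b).
  - by apply: eq_bigr => h _; case: (symdiff h); case: (tail h); case: (h.2); case: (int h); case: (h \in S).
  - move=> h; rewrite b_stable; case hC: (symdiff h) => //=; rewrite b_tail // region_paired // /int b_vertex //.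
    case v: (map_vertex h != None); last by rewrite !andbF.
    by rewrite b_color ?v //= addbN addNb negbK.
  - by move=> h /andP[hC _]; rewrite region_paired.
(* Of the two half-edges of an edge of the symmetric difference, one lies in S and one
  is white. *)
have F2a : \big[addb/false]_h (symdiff h && (h \in S) (+) symdiff h && ~~ h.2) = false.
  rewrite -[RHS](@parity_paired _ (fun h => symdiff h && ((h \in S) (+) ~~ h.2)) (fun h => h.2) (flip_perm G)).
  - by apply: eq_bigr => h _; case: (symdiff h).
  - move=> h; rewrite flip_permE symdiff_flip; case hC: (symdiff h) => //=.
    by move: hC; rewrite S_bd; case: (h \in S); case: (flip h \in S) => //=; case: (h.2).
  - by move=> h; rewrite flip_permE.
have F2b : \big[addb/false]_h [&& symdiff h, ~~ h.2 & int h] = false.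
  apply: (@parity_paired _ _ (fun h => h \in S) b) => h.
    rewrite b_stable; case hC: (symdiff h) => //=; rewrite /int b_vertex //.
    by case v: (map_vertex h != None); rewrite ?andbF // b_color.
  by move=> /andP[hC _]; rewrite region_paired.
have F3 : \big[addb/false]_h [&& h \in S, ~~ symdiff h & h.1 \in P] = false.
  apply: (@parity_paired _ _ (fun h => h.2) (flip_perm G)) => h; rewrite flip_permE //= symdiff_flip.
  by case hC: (symdiff h); rewrite ?andbF //; move: hC; rewrite S_bd; case: (h \in S); case: (flip h \in S).
have bdry (A : pred 'I_n) (B : pred H) : (forall i, A i = B (bhalf G i)) ->
    odd #|[set i | A i]| = \big[addb/false]_h (~~ int h && B h).
  move=> AB; rewrite -(card_imset _ (@bhalf_inj _ G)) odd_card_sum; apply: eq_bigr => h _.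
  apply/imsetP/idP => [[i]|/andP[/negPn/eqP/map_vertex_None[i ->]] Bh].
    by rewrite inE AB => Bi ->; rewrite /int map_vertex_bhalf.
  by exists i; rewrite // inE AB.
have p0_sum : p0 && odd #|[set h in S | last_half h]| =
    \big[addb/false]_h [&& p0, h \in S & last_half h].
  by case: p0 => /=; [rewrite odd_card_sum; apply: eq_bigr => h _; rewrite inE | rewrite big1].
rewrite odd_tail_walk odd_vertices_touched p0_sum.
rewrite (bdry _ (fun h => [&& h \in S, ~~ symdiff h & (h.1 \in P) == h.2])); last first.
  by move=> i; rewrite mem_boundary -bhalf2.
rewrite (bdry _ (fun h => symdiff h && ~~ h.2)); last by move=> i; rewrite bhalf2.
have int_last h : last_half h -> ~~ int h.
  by move=> /last_halfP[i -> _]; rewrite /int map_vertex_bhalf.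
have int_p0 h : p0 -> symdiff h -> int h.
  rewrite p0E => /existsPn no; case: (boolP (int h)) => // /negPn/eqP/map_vertex_None[i ->] hC.
  by have := no i; rewrite hC.
(* The two sides differ, half-edge by half-edge, by these cancelling terms. *)
pose FF h := ([&& symdiff h, tail h, ~~ h.2 & int h] (+) [&& symdiff h, h \in S, ~~ h.2 & int h])
  (+) (symdiff h && (h \in S) (+) symdiff h && ~~ h.2) (+) [&& symdiff h, ~~ h.2 & int h]
  (+) [&& h \in S, ~~ symdiff h & h.1 \in P].
have FF0 : \big[addb/false]_h FF h = false.
  by rewrite big_split /= F3 big_split /= F2b big_split /= F1 F2a.
set f := odd #|porbit _ @: _|; rewrite !odd_card_sum.
transitivity (f (+) \big[addb/false]_h (FF h (+) ((h \in [set h in S | ~~ symdiff h & ~~ h.2])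
  (+) (h \in [set h in S | [|| symdiff h, int h && (h.1 \in P) | p0 && last_half h]])
  (+) (h \in white_inner_tails)))).
  rewrite big_split FF0 /= !big_split /= !addbA.
  congr (_ (+) _ (+) _ (+) _); apply: eq_bigr => h _; rewrite !inE //.
  by rewrite -orbA.
rewrite -!addbA -!big_split /=; congr (_ (+) _); apply: eq_bigr => h _.
rewrite !inE -/(int h) /FF.
have := int_last h; have := @int_p0 h.
case: p0; case: (last_half h); case: (int h); case: (symdiff h) => //=;
  do ?[by move=> /(_ isT isT)]; do ?[by move=> _ /(_ isT)] => _ _;
  case: (h \in S); case: (tail h); case: (h.2); case: (h.1 \in P) => //.
Qed.

End Region.

Section Columns.
(* nu identifies the boundary columns joined by b at the point at infinity. *)
Variable nu : V -> V.
Hypothesis nu_int : forall v, nu (inl v) = inl v.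
Hypothesis nu_b : forall h, symdiff h -> ~~ tail h -> vert (b h) = nu (vert h).
Hypothesis nu_common : forall i,
  i \in matching_boundary P -> i \in matching_boundary Q -> nu (inr i) = inr i.

Variables (r : nat) (cf : 'I_r -> V) (p : {perm 'I_r}).
Hypothesis cf_inj : injective cf.
Hypothesis cf_black : forall v, black G (inl v) -> exists j, cf j = inl v.
Hypothesis cf_boundary : forall i, i \in matching_boundary Q -> exists j, cf j = inr i.
Hypothesis cf_codom : forall j, match cf j with
  | inl v => black G (inl v) | inr i => i \in matching_boundary Q end.
Hypothesis pE : forall j, cf (p j) = nu (mate P (mate Q (cf j))).

(** Going from a column to its row by Q and to the next column by P, one follows the
  tail walk and stops at every second vertex, except that row and column of a white
  boundary vertex coincide. So p is the first return of the tail walk to the complement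
  of the white interior vertices. *)
Lemma odd_column_perm :
  odd_perm p = odd_perm (restr_perm tails (flip_perm G * b)) (+) odd #|white_inner_tails|.
Proof.
have walk_stable : stable (flip_perm G * b) tails.
  move=> h; rewrite !inE permM flip_permE => /andP[hC ht].
  by rewrite b_symdiff // b_tail // tail_flip negbK ht.
have wE := restrE walk_stable; set w := restr_perm _ _ in wE *.
have wE' h : symdiff h -> tail h -> w h = b (flip h).
  by move=> hC ht; rewrite wE !inE hC ht permM flip_permE.
have Nbd i : bhalf G i \notin white_inner_tails.
  by rewrite inE map_vertex_bhalf eqxx !andbF.
have Nblack (h : H) : h.2 -> h \notin white_inner_tails by move=> h2; rewrite inE h2 !andbF.
have flip_tail (h : H) : tail h -> ~~ tail (flip h) by rewrite tail_flip negbK.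
have b2 (h : H) v : symdiff h -> ~~ tail h -> vert h = inl v -> vert (b h) = inl v /\ (b h).2 = h.2.
  by move=> hC ht hv; have := nu_b hC ht; rewrite hv nu_int => E; rewrite -!vert_black E hv.
have wN h : h \in white_inner_tails -> w h \notin white_inner_tails.
  rewrite inE => /and4P[hC ht h2 _]; rewrite wE' //.
  case E: (vert (flip h)) => [v|i].
    by apply: Nblack; have [_ ->] := b2 (flip h) _ hC (flip_tail h ht) E.
  have [j ->] : exists j, b (flip h) = bhalf G j.
    by apply: map_vertex_None; rewrite b_vertex // (vert_inr E) map_vertex_bhalf.
  exact: Nbd.
have [q qE <-] := odd_first_return wN.
apply/esym; apply: (@odd_perm_correspondence _ _ _ _ (tails :\: white_inner_tails)
  [set j | [exists t in tails :\: white_inner_tails, cf j == vert t]]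
  (fun t j => cf j == vert t)).
- move=> t tD; suff [j cj] : exists j, cf j = vert t.
    by exists j; rewrite ?cj // inE; apply/exists_inP; exists t; rewrite ?cj.
  move: tD; rewrite !inE => /andP[tN /andP[tC tt]].
  case E: (vert t) => [v|i].
    apply: cf_black; rewrite -E vert_black; apply: contraNT tN => t2.
    by rewrite tC tt t2 /map_vertex E.
  apply: cf_boundary; move: tC tt; rewrite (vert_inr E) tail_bhalf symdiff_bhalf.
  by case: (i \in matching_boundary P).
- by move=> j; rewrite inE => /exists_inP[t tD /eqP cj]; exists t; rewrite ?cj.
- by move=> t j j' /eqP E /eqP E'; apply: cf_inj; rewrite E.
- move=> t t' j; rewrite !inE => /andP[_ /andP[tC tt]] /andP[_ /andP[tC' tt']] /eqP E /eqP E'.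
  have mv : map_vertex t' = map_vertex t by rewrite /map_vertex -E' E.
  by case: (b_uniq tC tC' mv) => // E2; move: tt'; rewrite E2 b_tail // tt.
- move=> t; rewrite !inE negb_and negbK => /orP[] tN; rewrite qE inE.
    by rewrite tN.
  have wt : w t = t by rewrite wE !inE (negbTE tN).
  by rewrite !wt; case: ifP => // _; case: ifP.
- move=> j jD; apply: cf_inj; rewrite pE; have := cf_codom j.
  case E: (cf j) => [v|i] cj.
    have [g [vg gQ] _] := almost_perfectP _ AQ v.
    have g2 : g.2 by rewrite -vert_black vg.
    rewrite -vg mateE //; case gP: (g.1 \in P).
      by rewrite mateE // flipK vg nu_int.
    case/negP: jD; rewrite inE; apply/exists_inP; exists g; last by rewrite E vg.
    by rewrite !inE /symdiff /tail gP gQ g2.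
  case iC: (symdiff (bhalf G i)).
    case/negP: jD; rewrite inE; apply/exists_inP; exists (bhalf G i); last by rewrite E vert_bhalf.
    rewrite in_setD Nbd !inE iC tail_bhalf /=.
    by move: iC; rewrite symdiff_bhalf cj addbT.
  have iP : i \in matching_boundary P by move: iC; rewrite symdiff_bhalf cj addbT => /negbFE.
  rewrite (_ : mate P _ = inr i) ?nu_common //.
  case iQ : (used Q i); last first.
    have iP' : used P i = false.
      by move: iC; rewrite /symdiff -/(used P i) -/(used Q i) iQ addbF.
    by rewrite !mate_unused ?iQ ?iP'.
  have iP' : used P i by move: iC; rewrite /symdiff -/(used P i) -/(used Q i) iQ addbT => /negbFE.
  by rewrite -vert_bhalf mateE // mateE // flipK.
- move=> t j; rewrite !inE => /andP[tN /andP[tC tt]] /eqP cj; rewrite pE cj qE.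
  rewrite [in X in if X then _ else _]inE (negbTE tN).
  case t2: t.2.
    have [tP tQ] : t.1 \in P = false /\ t.1 \in Q.
      by move: tt tC; rewrite /tail /symdiff t2; case: (_ \in P) => //; case: (_ \in Q).
    rewrite (mateE AQ tQ); case E: (vert (flip t)) => [u|i].
      have [vb b2'] := b2 (flip t) _ tC (flip_tail t tt) E.
      have bt : tail (b (flip t)) by rewrite b_tail // flip_tail.
      have wtN : w t \in white_inner_tails.
        by rewrite inE wE' // b_symdiff //= bt b2' /= t2 /map_vertex vb.
      have bC : symdiff (b (flip t)) by exact: b_symdiff.
      have bP : (b (flip t)).1 \in P.
        by move: bt; rewrite /tail b2' /= t2 addbF.
      by rewrite wtN wE' // wE' // -vb mateE // nu_b // flip_tail.
    have [k bk] : exists j, b (flip t) = bhalf G j.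
      by apply: map_vertex_None; rewrite b_vertex // (vert_inr E) map_vertex_bhalf.
    rewrite wE' // bk (negbTE (Nbd k)) -bk nu_b ?flip_tail // E mate_unused //.
    by rewrite /used -(vert_inr E) /= tP.
  have E : map_vertex t = None.
    by move: tN; rewrite tC tt t2 /=; case: map_vertex.
  have [i ti] := map_vertex_None E.
  have [tP tQ] : t.1 \in P /\ (t.1 \in Q) = false.
    by move: tt tC; rewrite /tail /symdiff t2; case: (_ \in P) => //; case: (_ \in Q).
  have mQ : mate Q (vert t) = vert t.
    by rewrite ti vert_bhalf mate_unused // /used -ti tQ.
  rewrite mQ mateE // wE' //.
  have [v vt] := bhalf_int G i; rewrite -ti in vt.
  have [vb b2'] := b2 (flip t) _ tC (flip_tail t tt) vt.
  have bb : (b (flip t)).2 by rewrite b2' /= t2.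
  by rewrite (negbTE (Nblack _ bb)) vb vt nu_int.
Qed.

End Columns.
End Closed.

(** * Increasing enumerations and columns of minors *)

Section Increasing.
Variables k n : nat.
Implicit Types f g : 'I_k -> 'I_n.

Definition increasing f := {homo f : i j / (i < j)%N}.

Lemma increasing_lt f i j : increasing f -> (f i < f j) = (i < j).
Proof.
move=> fi; case: (ltngtP i j) => [/fi //|/fi ji|/val_inj ->]; last by rewrite ltnn.
by apply/negbTE; rewrite -leqNgt ltnW.
Qed.

Lemma increasing_inj f : increasing f -> injective f.
Proof.
move=> fi i j E; apply: val_inj; case: (ltngtP i j) => // /fi; by rewrite E ltnn.
Qed.

Lemma card_below f (A : {set 'I_n}) j : increasing f -> A = [set f i | i : 'I_k] ->
  #|[set x in A | x < f j]| = j.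
Proof.
move=> fi ->; have -> : [set x in [set f i | i : 'I_k] | x < f j] =
    [set f (widen_ord (ltnW (ltn_ord j)) i) | i : 'I_j].
  apply/setP=> x; rewrite inE; apply/andP/imsetP => [[/imsetP[i _ ->]]|[i _ ->]].
    rewrite increasing_lt // => ij; exists (Ordinal ij) => //.
    by congr f; apply: val_inj.
  by rewrite increasing_lt // imset_f //= ltn_ord.
rewrite card_imset ?card_ord // => i i' /(increasing_inj fi) /(congr1 val) /= E.
exact: val_inj.
Qed.

Lemma increasing_unique f g : increasing f -> increasing g ->
  [set f i | i : 'I_k] = [set g i | i : 'I_k] -> f =1 g.
Proof.
move=> fi gi E j; have : f j \in [set g i | i : 'I_k] by rewrite -E imset_f.
case/imsetP=> j' _ fj; rewrite fj; congr g; apply: val_inj => /=.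
by rewrite -(card_below j fi (erefl _)) E fj (card_below j' gi (erefl _)).
Qed.

Lemma card_increasing f (A : {set 'I_n}) : increasing f -> A = [set f i | i : 'I_k] -> #|A| = k.
Proof. by move=> fi ->; rewrite card_imset ?card_ord //; exact: increasing_inj. Qed.

End Increasing.

Section ColumnIndex.
Variables (n : nat) (G : bgraph n).
Local Notation V := (ivert G + 'I_n)%type.

Definition black_inner := [set v : ivert G | black G (inl v)].
Local Notation m := #|black_inner|.

(** The boundary columns come first: then the index type is a successor as soon as there
  is a boundary column, as lift_perm requires. *)
Definition column k (f : 'I_k -> 'I_n) (j : 'I_(k + m)) : V :=
  match split j with inl i => inr (f i) | inr x => inl (enum_val x) end.

Lemma column_lshift k (f : 'I_k -> 'I_n) i : column f (lshift m i) = inr (f i).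
Proof. by rewrite /column (unsplitK (inl i)). Qed.

Lemma column_rshift k (f : 'I_k -> 'I_n) x : column f (rshift k x) = inl (enum_val x).
Proof. by rewrite /column (unsplitK (inr x)). Qed.

Lemma column_inj k (f : 'I_k -> 'I_n) : injective f -> injective (column f).
Proof.
move=> fi j j'; rewrite -(splitK j) -(splitK j').
case: (split j) => i; case: (split j') => i' /=; rewrite ?column_lshift ?column_rshift //.
  by case=> /fi ->.
by case=> /enum_val_inj ->.
Qed.

Lemma column_black k (f : 'I_k -> 'I_n) v : black G (inl v) -> exists j, column f j = inl v.
Proof.
move=> vb; have vB : v \in black_inner by rewrite inE.
by exists (rshift k (enum_rank_in vB v)); rewrite column_rshift enum_rankK_in.
Qed.

Lemma column_codom k (f : 'I_k -> 'I_n) (A : {set 'I_n}) j : A = [set f i | i : 'I_k] ->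
  match column f j with inl v => black G (inl v) | inr i => i \in A end.
Proof.
move=> ->; rewrite -(splitK j); case: (split j) => i /=.
  by rewrite column_lshift imset_f.
by rewrite column_rshift; have := enum_valP i; rewrite inE.
Qed.

(** The two enumerations differ by moving one column from the position of a to the
  position of b past the columns in between. *)
Lemma exchange_column k (f g : 'I_k -> 'I_n) (A : {set 'I_n}) a b :
  increasing f -> increasing g -> a \notin A -> b \notin A ->
  a |: A = [set f i | i : 'I_k] -> b |: A = [set g i | i : 'I_k] ->
  exists2 d : {perm 'I_(k + m)},
    (forall j, column g (d j) = if column f j == inr a then inr b else column f j) &
    odd_perm d = odd #|[set x in A | x < a]| (+) odd #|[set x in A | x < b]|.
Proof.
move=> fi gi aA bA fA gB.
have /imsetP[ja _ fa] : a \in [set f i | i : 'I_k] by rewrite -fA setU11.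
have /imsetP[jb _ gb] : b \in [set g i | i : 'I_k] by rewrite -gB setU11.
case: k f g fi gi fA gB ja jb fa gb => [|k] f g fi gi fA gB ja jb fa gb; first by have := ltn_ord ja.
have liftE : (fun i => f (lift ja i)) =1 (fun i => g (lift jb i)).
  have inc (j : 'I_k.+1) (h : 'I_k.+1 -> 'I_n) : increasing h -> increasing (fun i => h (lift j i)).
    move=> hi i i' ii'; apply: hi => /=; rewrite /bump; move: ii'.
    by case: (leqP j i); case: (leqP j i') => /=; lia.
  apply: increasing_unique; try exact: inc.
  have im (h : 'I_k.+1 -> 'I_n) c j : increasing h -> c \notin A -> c = h j ->
      c |: A = [set h i | i : 'I_k.+1] -> [set h (lift j i) | i : 'I_k] = A.
    move=> hi cA cj E; rewrite cj in E cA; apply/setP=> x; apply/imsetP/idP => [[i _ ->]|xA].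
      have : h (lift j i) \in h j |: A by rewrite E imset_f.
      by rewrite in_setU1 => /orP[/eqP/(increasing_inj hi)/eqP|//]; rewrite eq_sym (negbTE (neq_lift j i)).
    have : x \in h j |: A by rewrite in_setU1 xA orbT.
    rewrite E => /imsetP[i _ xi]; case: (unliftP j i) => [i' ii|ij]; first by exists i'; rewrite // xi ii.
    by rewrite xi ij (negbTE cA) in xA.
  by rewrite (im f a) // (im g b).
exists (lift_perm (lshift m ja : 'I_(k + m).+1) (lshift m jb : 'I_(k + m).+1) 1).
  move=> j; case: (unliftP (lshift m ja : 'I_(k + m).+1) j) => [x ->|->].
    rewrite lift_perm_lift perm1 -(splitK x); case: (split x) => i /=.
      have l1 (j' : 'I_k.+1) : lift (lshift m j' : 'I_(k + m).+1) (lshift m i) = lshift m (lift j' i).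
        exact: val_inj.
      rewrite !l1 !column_lshift -liftE; case: eqP => // -[]; rewrite fa.
      by move=> /(increasing_inj fi)/eqP; rewrite eq_sym (negbTE (neq_lift ja i)).
    have r1 (j' : 'I_k.+1) : lift (lshift m j' : 'I_(k + m).+1) (rshift k i) = rshift k.+1 i.
      apply: val_inj; rewrite /= /bump (leq_trans (leq_ord j')) ?leq_addr //.
    by rewrite !r1 !column_rshift.
  by rewrite lift_perm_id !column_lshift -fa eqxx gb.
rewrite odd_lift_perm odd_perm1 addbF /=.
have below (h : 'I_k.+1 -> 'I_n) c j : increasing h -> c = h j ->
  c |: A = [set h i | i : 'I_k.+1] -> nat_of_ord j = #|[set x in A | x < c]|.
  move=> hi cj E; rewrite cj -(card_below j hi E); apply: eq_card => x.
  by rewrite !inE cj; case: eqP => // ->; rewrite ltnn !andbF.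
by rewrite -(below f a ja) // -(below g b jb).
Qed.

End ColumnIndex.

(** * Comparing two matchings whose boundaries differ by an exchange *)

Section Adjacent.
Variables (n : nat) (G : bgraph n) (D : disk_embedding G).
Local Notation H := (half_edge G).
Local Notation V := (ivert G + 'I_n)%type.
Local Notation m := #|black_inner G|.
Variables P Q : {set edge G}.
Hypotheses (AP : almost_perfect P) (AQ : almost_perfect Q).
Local Notation IP := (matching_boundary P).
Local Notation IQ := (matching_boundary Q).

Variable S : {set H}.
Hypothesis S_face : forall h, (flip (Defs.rot D h) \in S) = (h \in S).
Hypothesis S_bd : forall h, symdiff P Q h = (h \in S) (+) (flip h \in S).

Lemma last_half_count (l : 'I_n) : l.+1 = n ->
  odd #|[set h in S | last_half h]| = (bhalf G l \in S).
Proof.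
move=> ln; have lE h : last_half h = (h == bhalf G l).
  apply/existsP/eqP => [[i /andP[/eqP iE /eqP ->]]|->].
    by congr bhalf; apply: val_inj => /=; lia.
  by exists l; rewrite ln !eqxx.
case lS: (bhalf G l \in S).
  rewrite (_ : [set h in S | _] = [set bhalf G l]) ?cards1 //.
  by apply/setP=> h; rewrite !inE lE andbC; case: eqP => // ->.
rewrite (_ : [set h in S | _] = set0) ?cards0 //.
by apply/setP=> h; rewrite !inE lE andbC; case: eqP => // ->.
Qed.

(** Running through the boundary after its last half-edge, one enters or leaves S at the
  half-edges of the symmetric difference. *)
Lemma region_bhalf (l i : 'I_n) : l.+1 = n -> (bhalf G i \in S) =
  (bhalf G l \in S) (+) odd #|[set c : 'I_n | symdiff P Q (bhalf G c) && (c <= i)]|.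
Proof.
move=> ln; case: i => i; elim: i => [|i IH] lt_in; set i' := Ordinal lt_in.
  have oS : ordS l = i' by apply: val_inj; rewrite /= ln modnn.
  have := S_face (bhalf G l); rewrite (rot_boundary D) oS => <-.
  have -> : [set c : 'I_n | symdiff P Q (bhalf G c) && (c <= i')] =
      [set c in [set i'] | symdiff P Q (bhalf G i')].
    apply/setP=> c; rewrite !inE andbC leqn0; case: eqP => [c0|c0].
      have -> : c = i' by apply: val_inj.
      by rewrite eqxx.
    by rewrite (_ : c == i' = false) //; apply/eqP=> E; case: c0; rewrite E.
  have := S_bd (bhalf G i').
  case: (symdiff P Q _) => /=.
    rewrite (_ : [set c in _ | true] = [set i']) ?cards1; last by apply/setP=> c; rewrite !inE andbT.
    by case: (_ \in S); case: (_ \in S).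
  rewrite (_ : [set c in _ | false] = set0) ?cards0; last by apply/setP=> c; rewrite !inE andbF.
  by case: (_ \in S); case: (_ \in S).
have lt_in' := ltnW lt_in.
have oS : ordS (Ordinal lt_in') = i' by apply: val_inj; rewrite /= modn_small.
have := S_face (bhalf G (Ordinal lt_in')); rewrite (rot_boundary D) oS (IH lt_in').
have := S_bd (bhalf G i').
have -> : [set c : 'I_n | symdiff P Q (bhalf G c) && (c <= i')] =
    (if symdiff P Q (bhalf G i') then [set i'] else set0)
    :|: [set c : 'I_n | symdiff P Q (bhalf G c) && (c <= Ordinal lt_in')].
  apply/setP=> c; rewrite !inE /= leq_eqVlt ltnS andb_orr; congr (_ || _).
  case: (c =P i') => [->|ne]; first by rewrite eqxx andbT; case: ifP; rewrite !inE ?eqxx.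
  rewrite (_ : (c == i.+1 :> nat) = false) ?andbF; last by apply/eqP=> E; case: ne; apply: val_inj.
  by case: ifP; rewrite !inE //; case: eqP.
rewrite cardsU (_ : _ :&: _ = set0) ?cards0 ?subn0; last first.
  apply/setP=> c; rewrite !inE; case: ifP => _; rewrite !inE //.
  by case: eqP => // ->; rewrite /= ltnn andbF.
rewrite oddD.
move: (odd #|[set c : 'I_n | symdiff P Q (bhalf G c) && (c <= Ordinal lt_in')]|) => o.
case: (symdiff P Q (bhalf G i')); rewrite ?cards1 ?cards0;
  by case: (bhalf G i' \in S); case: (flip _ \in S); case: (bhalf G l \in S); case: o.
Qed.

Variables (k : nat) (y : 'I_(k + m) -> V).
Variables (f g : 'I_k -> 'I_n).
Hypotheses (f_inc : increasing f) (g_inc : increasing g).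
Hypotheses (fP : IP = [set f i | i : 'I_k]) (gQ : IQ = [set g i | i : 'I_k]).
Variables (sP sQ : {perm 'I_(k + m)}).
Hypothesis sPE : forall q, column f (sP q) = mate P (y q).
Hypothesis sQE : forall q, column g (sQ q) = mate Q (y q).

(** Each of the three terms adds over the faces of S. *)
Definition region_parity :=
  odd #|porbit (Defs.rot D * flip_perm G) @: S|
  (+) odd #|[set h in S | ~~ h.2 && (map_vertex h != None)]|
  (+) (~~ odd k && odd #|[set h in S | last_half h]|).

Definition white_boundary_parity :=
  odd #|[set i | symdiff P Q (bhalf G i) && ~~ black G (inr i)]|.

(** The symmetric difference avoids the point at infinity, so S contains all boundary
  half-edges or none. *)
Lemma odd_same_boundary : IP = IQ ->
  odd_perm sP (+) odd_perm sQ = region_parity (+) white_boundary_parity.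
Proof.
move=> PQ; have noC i : ~~ symdiff P Q (bhalf G i) by rewrite symdiff_bhalf PQ addbb.
have int h : symdiff P Q h -> exists v, vert h = inl v.
  case E: (vert h) => [v|i] hC; first by exists v.
  by have := noC i; rewrite -(vert_inr E) hC.
set b := switch_perm AP AQ; have bE h : b h = switch P Q h by rewrite permE.
have b_symdiff h : symdiff P Q h -> symdiff P Q (b h) by rewrite bE; exact: switch_symdiff.
have b_neq h : symdiff P Q h -> b h != h.
  by move=> hC; rewrite bE; have [v hv] := int _ hC; have [] := switch_int AP AQ hv hC.
have b_vertex h : symdiff P Q h -> map_vertex (b h) = map_vertex h.
  by rewrite bE /map_vertex vert_switch.
have b_uniq h h' : symdiff P Q h -> symdiff P Q h' -> map_vertex h' = map_vertex h -> h' = h \/ h' = b h.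
  move=> hC h'C; rewrite bE; have [v hv] := int _ hC; have [v' hv'] := int _ h'C.
  by rewrite /map_vertex hv hv' => -[E]; apply: switch_uniq; rewrite // hv hv' E.
have b_tail h : symdiff P Q h -> tail P (b h) = ~~ tail P h.
  by move=> hC; rewrite bE; have [v hv] := int _ hC; rewrite (tail_switch AP AQ hv).
have p0E : true = ~~ [exists i, symdiff P Q (bhalf G i)].
  by apply/esym/existsPn.
have fg : f =1 g by apply: increasing_unique; rewrite // -fP -gQ.
have cfg j : column f j = column g j by rewrite /column; case: (split j) => // i; rewrite fg.
have oddp : odd_perm (sQ^-1 * sP) = odd_perm (restr_perm (tails P Q) (flip_perm G * b))
    (+) odd #|white_inner_tails P Q|.
  apply: (@odd_column_perm _ _ _ _ AP AQ _ b_symdiff b_vertex b_uniq b_tail id _ _ _ _ (column g)) => //.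
  - by move=> h hC _; rewrite bE vert_switch.
  - exact/column_inj/increasing_inj.
  - by move=> v; exact: column_black.
  - move=> i; rewrite gQ => /imsetP[j _ ->]; exists (lshift m j); exact: column_lshift.
  - by move=> j; exact: column_codom.
  - by move=> j; rewrite permM -cfg sPE -{2}(permKV sQ j) sQE mateK.
move: oddp; rewrite odd_permM odd_permV addbC.
rewrite (odd_tail_walk_count AP AQ b_symdiff b_neq b_vertex b_uniq b_tail S_face S_bd p0E) => ->.
rewrite /region_parity /white_boundary_parity; congr (_ (+) _); rewrite -!addbA; do 2!congr (_ (+) _).
have kP := card_increasing f_inc fP.
rewrite andTb.
have [n0|n0] := posnP n.
  rewrite (_ : [set i | _] = set0) ?cards0; last first.
    by apply/setP=> i; have := ltn_ord i; rewrite {2}n0.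
  rewrite (_ : [set h in S | last_half h] = set0) ?cards0 ?andbF //.
  by apply/setP=> h; rewrite !inE; apply/negP=> /andP[_ /last_halfP[i _]]; lia.
have ltl : n.-1 < n by rewrite prednK.
pose l := Ordinal ltl; have ln : l.+1 = n by rewrite /= prednK.
have Si i : (bhalf G i \in S) = (bhalf G l \in S).
  rewrite (region_bhalf i ln) (_ : [set c | _] = set0) ?cards0 ?addbF //.
  by apply/setP=> c; rewrite !inE (negbTE (noC c)).
rewrite (last_half_count ln).
case lS: (bhalf G l \in S).
  rewrite (_ : [set i | _] = IP) ?kP; first by case: (odd k).
  by apply/setP=> i; rewrite inE Si lS noC.
rewrite (_ : [set i | _] = set0) ?cards0 ?andbF //.
by apply/setP=> i; rewrite in_set Si lS in_set0.
Qed.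

(** The symmetric difference has two half-edges at the point at infinity, and w joins
  them. Sorting the columns costs the parity of the number of common elements of I(P)
  and I(Q) between a and b; these are the common elements on one side of the rim of S,
  so the cost is absorbed by the boundary terms of odd_tail_walk_count. *)
Lemma odd_exchanged_boundary a b :
    a \in IP -> a \notin IQ -> b \in IQ -> b \notin IP ->
    (forall i, i != a -> i != b -> (i \in IP) = (i \in IQ)) ->
  odd_perm sP (+) odd_perm sQ = region_parity (+) white_boundary_parity.
Proof.
move=> aP aQ bQ bP same.
have ab : a != b by apply: contraNneq bP => <-.
have bdC i : symdiff P Q (bhalf G i) = (i == a) || (i == b).
  rewrite symdiff_bhalf; case: (eqVneq i a) => [->|ia] /=; first by rewrite aP (negbTE aQ).
  case: (eqVneq i b) => [->|ib] /=; first by rewrite bQ (negbTE bP).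
  by rewrite same // addbb.
have aC : symdiff P Q (bhalf G a) by rewrite bdC eqxx.
have bC : symdiff P Q (bhalf G b) by rewrite bdC eqxx orbT.
have swE h : switch_perm AP AQ h = switch P Q h by rewrite permE.
set w := switch_perm AP AQ * tperm (bhalf G a) (bhalf G b).
have wa : w (bhalf G a) = bhalf G b by rewrite permM swE switch_bhalf tpermL.
have wb : w (bhalf G b) = bhalf G a by rewrite permM swE switch_bhalf tpermR.
have wint h v : vert h = inl v -> w h = switch P Q h.
  move=> hv; rewrite permM swE tpermD //; apply/eqP=> E.
    by have := vert_switch P Q h; rewrite -E vert_bhalf hv.
  by have := vert_switch P Q h; rewrite -E vert_bhalf hv.
have C_case h : symdiff P Q h -> [\/ exists v, vert h = inl v, h = bhalf G a | h = bhalf G b].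
  case E: (vert h) => [v|i] hC; first by constructor 1; exists v.
  by move: hC; rewrite (vert_inr E) bdC => /orP[] /eqP ->; [constructor 2|constructor 3].
have w_symdiff h : symdiff P Q h -> symdiff P Q (w h).
  by move=> hC; case: (C_case h hC) => [[v hv]|->|->]; rewrite ?wa ?wb // (wint _ v) // switch_symdiff.
have w_neq h : symdiff P Q h -> w h != h.
  move=> hC; case: (C_case h hC) => [[v hv]|->|->]; rewrite ?wa ?wb ?(inj_eq (@bhalf_inj _ G)) //.
    by rewrite (wint _ v) //; have [] := switch_int AP AQ hv hC.
  by rewrite eq_sym.
have w_vertex h : symdiff P Q h -> map_vertex (w h) = map_vertex h.
  move=> hC; case: (C_case h hC) => [[v hv]|->|->]; rewrite ?wa ?wb ?map_vertex_bhalf //.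
  by rewrite (wint _ v) // /map_vertex vert_switch.
have w_uniq h h' : symdiff P Q h -> symdiff P Q h' -> map_vertex h' = map_vertex h -> h' = h \/ h' = w h.
  move=> hC h'C; case: (C_case h hC) => [[v hv]|->|->]; rewrite ?wa ?wb ?map_vertex_bhalf.
  - rewrite (wint _ v) // => E; apply: switch_uniq; rewrite // hv.
    by apply/map_vertex_int; rewrite E; apply/map_vertex_int.
  - by move=> /map_vertex_None[i h'i]; move: h'C; rewrite h'i bdC => /orP[] /eqP ->; [left|right].
  - by move=> /map_vertex_None[i h'i]; move: h'C; rewrite h'i bdC => /orP[] /eqP ->; [right|left].
have w_tail h : symdiff P Q h -> tail P (w h) = ~~ tail P h.
  move=> hC; case: (C_case h hC) => [[v hv]|->|->]; rewrite ?wa ?wb ?tail_bhalf ?aP ?bP //.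
  by rewrite (wint _ v) // (tail_switch AP AQ hv).
have p0E : false = ~~ [exists i, symdiff P Q (bhalf G i)].
  by apply/esym/negbTE; rewrite negbK; apply/existsP; exists a.
pose I0 := IP :&: IQ.
have aI : a \notin I0 by rewrite inE (negbTE aQ) andbF.
have bI : b \notin I0 by rewrite inE (negbTE bP).
have PI : IP = a |: I0.
  apply/setP=> i; rewrite in_setU1 in_setI; case: eqVneq => [->//|ia] /=.
  by case: (eqVneq i b) => [->|ib]; [rewrite (negbTE bP) | rewrite same // andbb].
have QI : IQ = b |: I0.
  apply/setP=> i; rewrite in_setU1 in_setI; case: (eqVneq i b) => [->//|ib] /=.
  by case: (eqVneq i a) => [->|ia]; [rewrite (negbTE aQ) andbF | rewrite same // andbb].
have [d dE oddd] := exchange_column G f_inc g_inc aI bI (etrans (esym PI) fP) (etrans (esym QI) gQ).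
pose nu (c : V) : V := if c == inr a then inr b else c.
have oddp : odd_perm (sQ^-1 * sP * d) = odd_perm (restr_perm (tails P Q) (flip_perm G * w))
    (+) odd #|white_inner_tails P Q|.
  apply: (@odd_column_perm _ _ _ _ AP AQ _ w_symdiff w_vertex w_uniq w_tail nu _ _ _ _ (column g)) => //.
  - move=> h hC ht; case: (C_case h hC) => [[v hv]|E|E].
    + by rewrite (wint _ v) // vert_switch /nu hv.
    + by rewrite E wa !vert_bhalf /nu eqxx.
    + by move: ht; rewrite E tail_bhalf bP.
  - move=> i iP iQ; rewrite /nu; case: eqP => // -[E].
    by move: iQ; rewrite E (negbTE aQ).
  - exact/column_inj/increasing_inj.
  - by move=> v; exact: column_black.
  - move=> i; rewrite gQ => /imsetP[j _ ->]; exists (lshift m j); exact: column_lshift.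
  - by move=> j; exact: column_codom.
  - move=> j; rewrite !permM dE sPE -/(nu _); congr (nu (mate P _)).
    by rewrite -{2}(permKV sQ j) sQE mateK.
move: oddp; rewrite !odd_permM odd_permV oddd.
rewrite (odd_tail_walk_count AP AQ w_symdiff w_neq w_vertex w_uniq w_tail S_face S_bd p0E).
rewrite andFb addbF -/white_boundary_parity => E.
(* What remains compares the common elements inside S with the positions of a and b. *)
suff key : odd #|[set i | [&& bhalf G i \in S, ~~ symdiff P Q (bhalf G i) & i \in IP]]| =
   (~~ odd k && odd #|[set h in S | last_half h]|)
   (+) odd #|[set x in I0 | x < a]| (+) odd #|[set x in I0 | x < b]|.
  move: E; rewrite key /region_parity.
  move: (odd_perm sP) (odd_perm sQ) (odd #|[set x in I0 | x < a]|) (odd #|[set x in I0 | x < b]|).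
  move: white_boundary_parity (~~ odd k && _) (odd _) (odd _).
  by do 8!case.
have ltl : n.-1 < n by rewrite prednK // (leq_ltn_trans _ (ltn_ord a)).
pose l := Ordinal ltl; have ln : l.+1 = n by rewrite /= prednK // (leq_ltn_trans _ (ltn_ord a)).
have Si i : i != a -> i != b -> (bhalf G i \in S) = (bhalf G l \in S) (+) (a < i) (+) (b < i).
  move=> ia ib; rewrite (region_bhalf i ln) -addbA; congr (_ (+) _).
  rewrite odd_card_sum (bigD1 a) //= (bigD1 b) /=; last by rewrite eq_sym.
  rewrite big1 => [|c /andP[ca cb]]; last by rewrite inE bdC (negbTE ca) (negbTE cb).
  rewrite !inE aC bC addbF /=; congr (_ (+) _); rewrite leq_eqVlt.
    by case: eqP => // /val_inj E'; rewrite E' eqxx in ia.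
  by case: eqP => // /val_inj E'; rewrite E' eqxx in ib.
rewrite (last_half_count ln).
have kI : odd k = ~~ odd #|I0|.
  by rewrite -(card_increasing f_inc fP) PI cardsU1 aI oddD.
rewrite kI negbK !odd_card_sum.
transitivity (\big[addb/false]_i ((i \in I0) && (bhalf G l \in S) (+)
   ((i \in [set x in I0 | x < a]) (+) (i \in [set x in I0 | x < b])))).
  apply: eq_bigr => i _; rewrite [in LHS]in_set !(in_set (fun x => (x \in I0) && _)) in_setI bdC.
  case: (eqVneq i a) => [->|ia] /=; first by rewrite (negbTE aQ) !andbF.
  case: (eqVneq i b) => [->|ib] /=; first by rewrite (negbTE bP) !andbF.
  rewrite Si // -same // andbb.
  have -> : (a < i) = ~~ (i < a) by rewrite -leqNgt [RHS]leq_eqVlt; case: eqP => // /val_inj E'; rewrite E' eqxx in ia.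
  have -> : (b < i) = ~~ (i < b) by rewrite -leqNgt [RHS]leq_eqVlt; case: eqP => // /val_inj E'; rewrite E' eqxx in ib.
  by case: (i \in IP); case: (_ \in S); case: (i < a); case: (i < b).
rewrite !big_split /= addbA; congr (_ (+) _ (+) _).
by case: (bhalf G l \in S); rewrite ?andbT ?andbF;
  [apply: eq_bigr => i _; rewrite andbT | rewrite big1 // => i _; rewrite andbF].
Qed.
End Adjacent.

(** * Switching a matching along a path *)

Lemma porbit_period (T : finType) (w : {perm T}) x i :
  (w ^+ i) x = x -> #|porbit w x| %| i.
Proof.
set N := #|porbit w x| => wi.
have Npos : 0 < N by rewrite lt0n card_porbit_neq0.
have itN : (w ^+ N) x = x by rewrite permX; exact: iter_porbit.
have wN j : (w ^+ (N * j)) x = x.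
  elim: j => [|j IH]; first by rewrite muln0 expg0 perm1.
  by rewrite mulnS expgD permM itN.
have wr : (w ^+ (i %% N)) x = x.
  by rewrite -{2}wi {2}(divn_eq i N) mulnC expgD permM wN.
have := uniq_traject_porbit w x; rewrite -/N => U.
have lt : i %% N < N by rewrite ltn_mod.
have := nth_uniq x _ _ U; move/(_ (i %% N) 0); rewrite !size_traject => /(_ lt Npos).
by rewrite !nth_traject // -permX wr eqxx => /esym/eqP E; apply/eqP.
Qed.

Lemma card_exchange (T : finType) (j : T -> T) (A B : {set T}) : injective j ->
  (forall x, x \in A -> j x \in B) -> (forall x, x \in B -> j x \in A) -> #|A| = #|B|.
Proof.
move=> ji AB BA; apply/eqP; rewrite eqn_leq -{1}(card_imset A ji) -{2}(card_imset B ji).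
by apply/andP; split; apply/subset_leq_card/subsetP=> _ /imsetP[x xA ->]; auto.
Qed.

Section ExchangePath.
Variables (n : nat) (G : bgraph n).
Local Notation H := (half_edge G).
Variables P Q : {set edge G}.
Hypotheses (AP : almost_perfect P) (AQ : almost_perfect Q).
Local Notation IP := (matching_boundary P).
Local Notation IQ := (matching_boundary Q).

Variable b : 'I_n.
Hypotheses (bP : b \notin IP) (bQ : b \in IQ).

(* O is the path of the symmetric difference that starts at b, as an orbit of the
  dihedral group generated by switch and flip. *)
Let w := switch_perm AP AQ * flip_perm G.
Let x := bhalf G b.
Let O := porbit w x.

Let wE h : w h = flip (switch P Q h).
Proof. by rewrite permM !permE. Qed.

(** The start of the path is fixed by switch, so switch reverses the path. *)
Let switch_power i : switch P Q ((w ^+ i) x) = (w^-1 ^+ i) x.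
Proof.
elim: i => [|i IH]; first by rewrite !expg0 !perm1 switch_bhalf.
rewrite !expgSr (permM (w ^+ i)) (permM (w^-1 ^+ i)) -IH; apply: (@perm_inj _ w).
by rewrite permKV !wE (switchK AP AQ) flipK.
Qed.

Let switch_O h : h \in O -> switch P Q h \in O.
Proof.
by move=> /porbitP[i ->]; rewrite switch_power /O -porbitV; exact: mem_porbit.
Qed.

Let flip_O h : h \in O -> flip h \in O.
Proof.
move=> hO; have := porbit_step w x (switch P Q h); rewrite -/O wE (switchK AP AQ) => ->.
exact: switch_O.
Qed.

Let O_symdiff h : h \in O -> symdiff P Q h.
Proof.
apply: (@porbit_ind _ _ (fun h => is_true (symdiff P Q h))).
  by rewrite symdiff_bhalf (negbTE bP) bQ.
by move=> y _ yC; rewrite wE symdiff_flip switch_symdiff.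
Qed.

Let O_bd := [set i | bhalf G i \in O].

(** A path has at most two ends: the reflection switch fixes the start of the orbit and
  at most the point opposite to it. *)
Let card_O_bd : #|O_bd| <= 2.
Proof.
set N := #|O|.
have half (i : 'I_n) : i \in O_bd -> bhalf G i = x \/ ~~ odd N /\ bhalf G i = (w ^+ (N./2)) x.
  rewrite inE => iO; have : bhalf G i \in traject w x N by rewrite -porbit_traject.
  case/trajectP=> j jN ij; rewrite -permX in ij.
  have : (w ^+ (j + j)) x = x.
    rewrite expgD permM; apply: (@perm_inj _ (w ^- j)); rewrite permK -expgVn -switch_power -ij.
    by rewrite switch_bhalf.
  move=> /porbit_period; rewrite -/O -/N => /dvdnP[c jc].
  have Npos : 0 < N by rewrite lt0n card_porbit_neq0.
  clearbody N; case: c jc => [|[|c]] jc.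
  - by left; rewrite ij (_ : j = 0) ?expg0 ?perm1 //; lia.
  - by right; split; [lia | rewrite ij; congr ((w ^+ _) x); lia].
  - by nia.
rewrite -(card_imset _ (@bhalf_inj _ G)).
apply: leq_trans (_ : #|[set x; (w ^+ (N./2)) x]| <= _); last by rewrite cards2; case: eqP.
apply/subset_leq_card/subsetP=> _ /imsetP[i /half iO ->]; rewrite !inE.
by case: iO => [->|[_ ->]]; rewrite eqxx ?orbT.
Qed.

(** Both flip and switch exchange tails and heads, except that switch fixes the ends of
  the path; so the path ends in I(P) if it starts in the complement. *)
Let balance : #|[set i in O_bd | i \in IP]| = #|[set i in O_bd | i \notin IP]|.
Proof.
pose half (c : bool) := [set h in O | tail P h == c].
pose inner (c : bool) := [set h in O | (map_vertex h != None) && (tail P h == c)].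
have half_eq : #|half true| = #|half false|.
  apply: (@card_exchange _ (@flip (edge G))); first exact: can_inj (@flipK _).
    by move=> h; rewrite !inE tail_flip => /andP[/flip_O -> /eqP ->].
  by move=> h; rewrite !inE tail_flip => /andP[/flip_O -> /eqP ->].
have inner_swap c h : h \in inner c -> switch P Q h \in inner (~~ c).
  rewrite !inE => /and3P[hO hv /eqP <-]; rewrite switch_O //=.
  case v: (map_vertex h) hv => [u|//] _; have /map_vertex_int hu := v.
  by rewrite (tail_switch AP AQ hu (O_symdiff hO)) eqxx /map_vertex vert_switch hu.
have inner_eq : #|inner true| = #|inner false|.
  by apply: (card_exchange (inv_inj (switchK AP AQ))) => h; exact: inner_swap.
have split c : #|half c| = #|inner c| + #|[set i in O_bd | (i \notin IP) == c]|.
  rewrite -[X in _ + X](card_imset _ (@bhalf_inj _ G)).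
  rewrite -cardsUI (_ : _ :&: _ = set0) ?cards0 ?addn0; last first.
    apply/setP=> h; rewrite !inE; apply/negP=> /andP[/and3P[_ hv _] /imsetP[i _ hi]].
    by rewrite hi map_vertex_bhalf in hv.
  apply: eq_card => h; rewrite in_setU !(in_set (fun h => (h \in O) && _)).
  case v: (map_vertex h) => [u|] /=.
    by rewrite orbC; case: imsetP => // -[i _ hi]; rewrite hi map_vertex_bhalf in v.
  rewrite andbF /=; have [i ->] := map_vertex_None v.
  apply/idP/imsetP => [hi|[j]]; first by exists i; rewrite // in_set [i \in O_bd]in_set -tail_bhalf.
  by rewrite in_set [j \in O_bd]in_set -tail_bhalf => hj /bhalf_inj ->.
have := split true; rewrite half_eq split inner_eq => /addnI.
by rewrite (_ : [set i in O_bd | (i \notin IP) == false] = [set i in O_bd | i \in IP]) //;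
  [move=> ->; apply: eq_card | apply/setP] => i; rewrite !in_set ?eqb_id // eqbF_neg negbK.
Qed.

(** P' is P switched along the path of the symmetric difference that starts at b; a is
  the other end of this path. *)
Lemma exchange_path : exists a (P' : {set edge G}),
  [/\ almost_perfect P', a \in IP, a \notin IQ &
    matching_boundary P' = b |: IP :\ a].
Proof.
have bO : b \in O_bd by rewrite inE porbit_id.
have [a aO [aP uniq_a]] : exists2 a, a \in O_bd & a \in IP /\ O_bd = [set a; b].
  have : 0 < #|[set i in O_bd | i \in IP]|.
    by rewrite balance card_gt0; apply/set0Pn; exists b; rewrite inE bO.
  rewrite card_gt0 => /set0Pn[a]; rewrite inE => /andP[aO aP]; exists a => //; split=> //.
  apply/esym/eqP; rewrite eqEcard cards2 (_ : a != b) ?card_O_bd ?andbT.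
    by apply/subsetP=> i; rewrite !inE => /orP[] /eqP ->; move: aO bO; rewrite !inE.
  by apply: contraNneq bP => <-.
have aQ : a \notin IQ.
  by move: aO; rewrite inE => /O_symdiff; rewrite symdiff_bhalf aP.
have O_edge h : ((h.1, true) \in O) = (h \in O).
  case: h => e [] //=; apply/idP/idP => /flip_O; exact: id.
pose P' := [set e | (e \in P) (+) ((e, true) \in O)].
have P'O h : h \in O -> (h.1 \in P') = (h.1 \in Q).
  move=> hO; rewrite inE O_edge hO; have := O_symdiff hO; rewrite /symdiff.
  by case: (_ \in P); case: (_ \in Q).
have P'nO h : h \notin O -> (h.1 \in P') = (h.1 \in P).
  by move=> /negbTE hO; rewrite inE O_edge hO addbF.
exists a, P'; split=> //.
  apply/almost_perfectP => v; have [d [dv dP] dU] := almost_perfectP _ AP v.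
  case: (boolP (d \in O)) => dO.
    have dC := O_symdiff dO; have sO := switch_O dO.
    have sE : switch P Q d = matched_half Q d by rewrite /switch dC dP.
    have sQ : (switch P Q d).1 \in Q by rewrite sE; exact: matched_half_in dv.
    have sv : vert (switch P Q d) = inl v by rewrite vert_switch.
    exists (switch P Q d); rewrite ?P'O // => h hv hP'.
    case: (boolP (h \in O)) => hO.
      by apply: (unique_at AQ); rewrite ?sv // -P'O.
    by move: (hO); rewrite (dU h) ?dO // -P'nO.
  exists d; rewrite ?P'nO // => h hv hP'.
  case: (boolP (h \in O)) => hO; last by apply: dU; rewrite // -P'nO.
  have hC := O_symdiff hO; have hQ : h.1 \in Q by rewrite -P'O.
  have hP : (h.1 \in P) = false by move: hC; rewrite /symdiff hQ; case: (_ \in P).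
  have : switch P Q h \in O by exact: switch_O.
  rewrite /switch hC hP (_ : matched_half P h = d) ?(negbTE dO) //.
  by apply: (matched_half_eq AP); rewrite ?dv.
apply/setP=> i; rewrite in_setU1 in_setD1 !mem_boundary.
case: (boolP (i \in O_bd)) => iO.
  move: (iO); rewrite inE => /P'O; rewrite -/(used P' i) -/(used Q i) => ->.
  rewrite -mem_boundary; move: iO; rewrite uniq_a in_set2 => /orP[] /eqP ->.
    by rewrite eqxx (negbTE aQ); case: eqP => // ab; move: aQ; rewrite ab bQ.
  by rewrite eqxx.
move: (iO); rewrite inE => /P'nO; rewrite -/(used P' i) -/(used P i) => ->.
by move: iO; rewrite uniq_a !inE negb_or => /andP[-> /negbTE ->].
Qed.

End ExchangePath.

(** * Kasteleyn signs *)

Lemma increasing_enumeration n k (A : {set 'I_n}) : #|A| = k ->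
  exists2 f : 'I_k -> 'I_n, increasing f & A = [set f i | i : 'I_k].
Proof.
move=> <-; exists (fun i : 'I_#|A| => enum_val i); last first.
  apply/setP=> x; apply/idP/imsetP => [xA|[i _ ->]]; last exact: enum_valP.
  by exists (enum_rank_in xA x); rewrite ?enum_rankK_in.
have srt : sorted ltn (map val (enum A)).
  rewrite {1}/enum_mem -enumT sorted_map; apply: sorted_filter.
    by move=> x y z; apply: ltn_trans.
  by rewrite -sorted_map val_enum_ord; exact: iota_ltn_sorted.
move=> i j ij; have x0 := enum_val i.
rewrite !(enum_val_nth x0) -!(nth_map x0 0 val) -?cardE ?ltn_ord //.
by apply: (sorted_ltn_nth ltn_trans) => //; rewrite inE size_map -cardE ltn_ord.
Qed.

Section Rows.
Variables (n : nat) (G : bgraph n).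
Local Notation H := (half_edge G).
Local Notation V := (ivert G + 'I_n)%type.
Local Notation m := #|black_inner G|.

Implicit Types P Q : {set edge G}.

Definition white_vertices := [set u : V | ~~ black G u].

Definition column_set (A : {set 'I_n}) : {set V} :=
  [set c | match c with inl v => black G (inl v) | inr i => i \in A end].

Lemma black_flip (h : H) : black G (vert (flip h)) = ~~ black G (vert h).
Proof. by rewrite !vert_black. Qed.

Lemma mate_white P (u : V) : almost_perfect P -> ~~ black G u ->
  mate P u \in column_set (matching_boundary P).
Proof.
move=> AP ub; rewrite inE; case: u ub => [v|i] ub.
  have [h [hv hP] _] := almost_perfectP _ AP v; rewrite -hv mateE //.
  have := black_flip h; rewrite hv ub; case E: (vert (flip h)) => [w|j] // jb.
  rewrite mem_boundary jb /used -(vert_inr E) /= hP //.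
case uP: (used P i); last by rewrite mate_unused ?uP // mem_boundary uP (negbTE ub).
rewrite -vert_bhalf mateE //; have [w wE] := bhalf_int G i.
by rewrite wE -wE black_flip vert_bhalf.
Qed.

Lemma mate_column P c : almost_perfect P -> c \in column_set (matching_boundary P) ->
  ~~ black G (mate P c).
Proof.
move=> AP; rewrite inE; case: c => [v vb|i].
  have [h [hv hP] _] := almost_perfectP _ AP v; rewrite -hv mateE //.
  by rewrite black_flip hv vb.
rewrite mem_boundary; case uP: (used P i) => /eqP ib.
  by rewrite -vert_bhalf mateE // black_flip vert_bhalf -ib.
by rewrite mate_unused ?uP // -ib.
Qed.

Lemma card_column_set A : #|column_set A| = #|A| + m.
Proof.
have -> : column_set A = inr @: A :|: inl @: black_inner G.
  apply/setP=> -[v|i]; rewrite !inE.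
    rewrite (_ : (inl v \in inr @: A) = false) /=; last by apply/negP=> /imsetP[].
    by rewrite mem_imset ?inE //; move=> ? ? [].
  rewrite (_ : (inr i \in inl @: _) = false) ?orbF; last by apply/negP=> /imsetP[].
  by rewrite mem_imset ?inE //; move=> ? ? [].
rewrite cardsU (_ : _ :&: _ = set0) ?cards0 ?subn0.
  by rewrite !card_imset //; move=> ? ? [].
by apply/setP=> c; rewrite !inE; apply/negP=> /andP[/imsetP[? _ ->] /imsetP[]].
Qed.

(** mate is a bijection from rows to columns. *)
Lemma card_matching_boundary P : almost_perfect P ->
  #|white_vertices| = #|matching_boundary P| + m.
Proof.
move=> AP; rewrite -card_column_set.
have inj := inv_inj (mateK AP).
apply/eqP; rewrite eqn_leq -{1}(card_imset _ inj) -{2}(card_imset (column_set _) inj).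
apply/andP; split; apply/subset_leq_card/subsetP=> _ /imsetP[u uW ->].
  by apply: mate_white => //; rewrite inE in uW.
by rewrite inE mate_column.
Qed.

Variables (k : nat) (y : 'I_(k + m) -> V).
Hypotheses (y_inj : injective y) (y_white : forall q, ~~ black G (y q)).

Lemma column_onto (f : 'I_k -> 'I_n) A c : A = [set f i | i : 'I_k] ->
  c \in column_set A -> exists j, column f j = c.
Proof.
move=> fA; rewrite inE; case: c => [v|i]; first exact: column_black.
by rewrite fA => /imsetP[j _ ->]; exists (lshift _ j); exact: column_lshift.
Qed.

(** This is the term of the Leibniz formula that belongs to P. *)
Lemma matching_perm P (f : 'I_k -> 'I_n) : almost_perfect P -> injective f ->
  matching_boundary P = [set f i | i : 'I_k] ->
  exists s : {perm 'I_(k + m)}, forall q, column f (s q) = mate P (y q).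
Proof.
move=> AP fi fP.
have ex q : exists j, column f j == mate P (y q).
  by have [j jE] := column_onto fP (mate_white AP (y_white q)); exists j; apply/eqP.
pose s q := xchoose (ex q).
have sE q : column f (s q) = mate P (y q) by apply/eqP/(xchooseP (ex q)).
have si : injective s.
  move=> q q' E; apply: y_inj; apply: (inv_inj (mateK AP)).
  by rewrite -!sE E.
by exists (perm si) => q; rewrite permE.
Qed.

End Rows.

Section Kasteleyn.
Variables (n : nat) (G : planar_bgraph n).
Local Notation H := (half_edge G).
Local Notation V := (ivert G + 'I_n)%type.
Local Notation m := #|black_inner G|.
Let D := pembedding G.
Variables (k : nat) (y : 'I_(k + m) -> V).
Hypotheses (y_inj : injective y) (y_white : forall q, ~~ black G (y q)).
Hypothesis rows_card : #|white_vertices G| = k + m.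

Implicit Types P Q : {set edge G}.

(** The parity of the number of minus signs around a face. Away from the boundary it is
  one plus half of the length of the face, as in the theorem of Kasteleyn on perfect
  matchings. *)
Definition face_parity (O : {set H}) : bool :=
  true (+) odd #|[set h in O | ~~ h.2 && (map_vertex h != None)]|
  (+) (~~ odd k && odd #|[set h in O | last_half h]|).

Lemma faces_sum (S : {set H}) (F : H -> bool) :
  (forall h, (flip (Defs.rot D h) \in S) = (h \in S)) ->
  odd #|[set h in S | F h]| = \big[addb/false]_(O in porbit (Defs.rot D * flip_perm G) @: S)
    odd #|[set h in O | F h]|.
Proof.
move=> S_face; set p := porbit _.
rewrite odd_card_sum (eq_bigr (fun h => (h \in S) && F h)); last by move=> h _; rewrite inE.
rewrite (bigID (fun h => h \in S)) /= [X in _ (+) X]big1 ?addbF; last by move=> h /negbTE ->.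
rewrite (partition_big_imset p) /=; apply: eq_bigr => _ /imsetP[g gS ->].
rewrite odd_card_sum [RHS](bigID (fun h => (h \in S) && (p h == p g))) /=.
rewrite [X in _ = _ (+) X]big1 ?addbF.
  by apply: eq_bigr => h /andP[hS /eqP hg]; rewrite inE hS -hg porbit_id.
move=> h hg; rewrite inE; apply/negbTE; apply: contra hg => /andP[hg _].
rewrite eq_porbit_mem hg andbT; apply: (@porbit_ind _ _ (fun h => is_true (h \in S)) g _ _ _ hg) => // h' _.
by rewrite permM flip_permE S_face.
Qed.

Lemma region_parity_sum (S : {set H}) :
  (forall h, (flip (Defs.rot D h) \in S) = (h \in S)) ->
  region_parity D S k = \big[addb/false]_(O in porbit (Defs.rot D * flip_perm G) @: S) face_parity O.
Proof.
move=> S_face; rewrite /region_parity !big_split /=; congr (_ (+) _ (+) _).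
- by rewrite odd_card_sum [RHS]big_mkcond; apply: eq_bigr => O _; case: (_ \in _).
- exact: faces_sum.
- rewrite (faces_sum _ S_face); by case: (~~ odd k) => /=; [apply: eq_bigr | rewrite big1].
Qed.

(** At an interior vertex each of the matchings uses one half-edge; at the point at
  infinity the number of used half-edges has the parity of k plus the number of white
  boundary vertices. *)
Lemma even_degree P Q h : almost_perfect P -> almost_perfect Q ->
  ~~ odd #|[set h' in porbit (Defs.rot D) h | h'.1 \in [set e | (e \in P) (+) (e \in Q)]]|.
Proof.
move=> AP AQ.
have at_vertex A : almost_perfect A ->
   odd #|[set h' in porbit (Defs.rot D) h | h'.1 \in A]| =
   if map_vertex h is None then odd k (+) odd #|[set i | ~~ black G (inr i)]| else true.
  move=> AA; case v: (map_vertex h) => [w|].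
    have [g [gw gA] gU] := almost_perfectP _ AA w.
    rewrite (_ : [set h' in _ | _] = [set g]) ?cards1 //; apply/setP=> h'.
    rewrite !inE porbit_rot v; apply/andP/eqP => [[/eqP/map_vertex_int hw hA]|->].
      exact: gU.
    by split=> //; apply/eqP/map_vertex_int.
  rewrite (_ : [set h' in _ | _] = bhalf G @: [set i | used A i]); last first.
    apply/setP=> h'; rewrite inE porbit_rot v; apply/andP/imsetP => [[/eqP/map_vertex_None[i ->] hA]|[i]].
      by exists i; rewrite ?inE.
    by rewrite inE => uA ->; rewrite map_vertex_bhalf.
  rewrite card_imset; last exact: bhalf_inj.
  have -> : k = #|matching_boundary A|.
    by apply/eqP; rewrite -(eqn_add2r m) -rows_card (card_matching_boundary AA).
  rewrite !odd_card_sum -big_split; apply: eq_bigr => i _.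
  by rewrite mem_boundary !inE; case: (used A i); case: (black G _).
rewrite odd_card_sum (eq_bigr (fun h' => (h' \in [set h' in porbit (Defs.rot D) h | h'.1 \in P]) (+)
   (h' \in [set h' in porbit (Defs.rot D) h | h'.1 \in Q]))); last first.
  by move=> h' _; rewrite !inE; case: (_ \in porbit _ _).
by rewrite big_split /= -!odd_card_sum !at_vertex // addbb.
Qed.

Lemma white_boundary_sum P Q :
  @white_boundary_parity n G P Q =
  \big[addb/false]_(e | (e \in P) (+) (e \in Q)) (map_vertex ((e, false) : H) == None).
Proof.
rewrite /white_boundary_parity.
rewrite (_ : #|_| = #|[set e | ((e \in P) (+) (e \in Q)) && (map_vertex ((e, false) : H) == None)]|).
  by rewrite odd_card_sum [RHS]big_mkcond; apply: eq_bigr => e _; rewrite inE; case: (_ (+) _).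
have E i : ~~ black G (inr i) -> bhalf G i = ((bhalf G i).1, false).
  by rewrite -bhalf2; case: (bhalf G i) => e [].
rewrite -(@card_in_imset _ _ (fun i => (bhalf G i).1)); last first.
  move=> i j; rewrite !inE => /andP[_ ib] /andP[_ jb] ij.
  by apply: (@bhalf_inj _ G); rewrite (E i) // (E j) // ij.
apply: eq_card => e; rewrite inE; apply/imsetP/andP => [[i]|[eC /eqP/map_vertex_None[i ei]]].
  by rewrite inE => /andP[iC ib] ->; split=> //; rewrite -E // map_vertex_bhalf.
exists i; rewrite ?inE -?ei //=; apply/andP; split=> //.
by rewrite -bhalf2 -ei.
Qed.

(** Signs with product prescribed by face_parity around each face exist by
  coboundary_exists, since the obstruction compares a matching with itself. An
  additional sign on the edges at white boundary vertices cancels white_boundary_parity.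
  By even_edges_bound these signs compare P and Q if their boundaries are equal or
  differ by an exchange; in general a chain of exchanges leads from P to Q. *)
Lemma kasteleyn_signs : (exists P : {set edge G}, almost_perfect P) ->
  exists eps : edge G -> bool, forall P Q (f g : 'I_k -> 'I_n) (sP sQ : {perm 'I_(k + m)}),
    almost_perfect P -> almost_perfect Q -> increasing f -> increasing g ->
    matching_boundary P = [set f i | i : 'I_k] ->
    matching_boundary Q = [set g i | i : 'I_k] ->
    (forall q, column f (sP q) = mate P (y q)) ->
    (forall q, column g (sQ q) = mate Q (y q)) ->
    odd_perm sP (+) \big[addb/false]_(e in P) eps e =
    odd_perm sQ (+) \big[addb/false]_(e in Q) eps e.
Proof.
move=> [P0 AP0].
have flipE h : flip_perm G h = flip h by exact: flip_permE.
have card_bd P : almost_perfect P -> #|matching_boundary P| = k.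
  by move=> AP; apply/eqP; rewrite -(eqn_add2r m) -rows_card (card_matching_boundary AP).
have [eps0 eps0E] : exists eps : edge G -> bool, forall S : {set H},
    (forall h, (flip_perm G (Defs.rot D h) \in S) = (h \in S)) ->
    \big[addb/false]_(e | ((e, true) \in S) (+) ((e, false) \in S)) eps e
    = \big[addb/false]_(O in porbit (Defs.rot D * flip_perm G) @: S) face_parity O.
  apply: coboundary_exists => // S S_face S_flip.
  have S_face' h : (flip (Defs.rot D h) \in S) = (h \in S) by rewrite -flipE S_face.
  rewrite -(region_parity_sum S_face').
  have [f f_inc fP] := increasing_enumeration (card_bd _ AP0).
  have [s sE] := matching_perm y_inj y_white AP0 (increasing_inj f_inc) fP.
  have S_bd h : symdiff P0 P0 h = (h \in S) (+) (flip h \in S).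
    by rewrite /symdiff -flipE S_flip !addbb.
  have := odd_same_boundary AP0 AP0 S_face' S_bd f_inc f_inc fP fP sE sE (erefl _).
  rewrite addbb white_boundary_sum big_pred0 ?addbF // => e; by rewrite addbb.
pose eps e := eps0 e (+) (map_vertex ((e, false) : H) == None).
exists eps.
have sum_diff P Q : \big[addb/false]_(e in P) eps e (+) \big[addb/false]_(e in Q) eps e =
    \big[addb/false]_(e | (e \in P) (+) (e \in Q)) eps e.
  rewrite [X in X (+) _]big_mkcond [X in _ (+) X]big_mkcond [RHS]big_mkcond -big_split /=.
  by apply: eq_bigr => e _; case: (e \in P); case: (e \in Q); rewrite //= ?addbb ?addbF.
have region P Q : almost_perfect P -> almost_perfect Q -> exists S : {set H},
   [/\ forall h, (flip (Defs.rot D h) \in S) = (h \in S),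
     forall h, symdiff P Q h = (h \in S) (+) (flip h \in S) &
     region_parity D S k (+) @white_boundary_parity n G P Q =
     \big[addb/false]_(e in P) eps e (+) \big[addb/false]_(e in Q) eps e].
  move=> AP AQ.
  have [S [S_face S_bd]] := @even_edges_bound (edge G) (Defs.rot D) (flip_perm G) flipE
     (rot_planar D) [set e | (e \in P) (+) (e \in Q)] (fun h => even_degree h AP AQ).
  have S_face' h : (flip (Defs.rot D h) \in S) = (h \in S) by rewrite -flipE S_face.
  have S_bd' h : symdiff P Q h = (h \in S) (+) (flip h \in S) by rewrite -flipE -S_bd inE.
  exists S; split=> //.
  rewrite (region_parity_sum S_face') -(eps0E _ S_face) white_boundary_sum sum_diff big_split /=.
  by congr (_ (+) _); apply: eq_bigl => e; have := S_bd' (e, true).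
have step P Q (f g : 'I_k -> 'I_n) (sP sQ : {perm 'I_(k + m)}) :
    almost_perfect P -> almost_perfect Q ->  increasing f -> increasing g ->
    matching_boundary P = [set f i | i : 'I_k] ->
    matching_boundary Q = [set g i | i : 'I_k] ->
    (forall q, column f (sP q) = mate P (y q)) ->
    (forall q, column g (sQ q) = mate Q (y q)) ->
    matching_boundary P = matching_boundary Q \/
    (exists a b, [/\ a \in matching_boundary P, a \notin matching_boundary Q,
       b \in matching_boundary Q, b \notin matching_boundary P &
      (forall i, i != a -> i != b -> (i \in matching_boundary P) = (i \in matching_boundary Q))]) ->
    odd_perm sP (+) \big[addb/false]_(e in P) eps e =
    odd_perm sQ (+) \big[addb/false]_(e in Q) eps e.
  move=> AP AQ fi gi fP gQ sPE sQE PQ; have [S [S_face S_bd SE]] := region P Q AP AQ.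
  have : odd_perm sP (+) odd_perm sQ = region_parity D S k (+) @white_boundary_parity n G P Q.
    case: PQ => [PQ|[a [b [aP aQ bQ bP same]]]].
      exact: (odd_same_boundary AP AQ S_face S_bd fi gi fP gQ sPE sQE PQ).
    exact: (odd_exchanged_boundary AP AQ S_face S_bd fi gi fP gQ sPE sQE aP aQ bQ bP same).
  rewrite SE; case: (odd_perm sP); case: (odd_perm sQ);
    by case: (\big[addb/false]_(e in P) _); case: (\big[addb/false]_(e in Q) _).
move=> P Q f g sP sQ.
(* An exchange lowers the number of elements of I(Q) outside of I(P). *)
elim: {P}_.+1 {-2}P f sP (ltnSn #|matching_boundary Q :\: matching_boundary P|) => // c IH P f sP lt_c.
move=> AP AQ fi gi fP gQ sPE sQE.
have [sub|] := boolP (matching_boundary Q \subset matching_boundary P).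
  apply: (step P Q f g) => //; left; apply/esym/eqP.
  by rewrite eqEcard sub !card_bd /=.
case/subsetPn => b bQ bP.
have [a [P' [AP' aP aQ P'E]]] := exchange_path AP AQ bP bQ.
have ab : a != b by apply: contraNneq bP => <-.
have [f' f'i f'P] := increasing_enumeration (card_bd _ AP').
have [s' s'E] := matching_perm y_inj y_white AP' (increasing_inj f'i) f'P.
transitivity (odd_perm s' (+) \big[addb/false]_(e in P') eps e).
  apply: (step P P' f f') => //; right; exists a, b; rewrite P'E !in_setU1 !in_setD1 !eqxx (negbTE ab) bP.
  split=> // i ia ib; by rewrite in_setU1 in_setD1 ia (negbTE ib).
apply: (IH P' f' s') => //.
rewrite -ltnS; apply: leq_trans lt_c; rewrite ltnS; apply: proper_card.
rewrite properE; apply/andP; split.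
  apply/subsetP=> i; rewrite P'E !in_setD in_setU1 in_setD1 negb_or negb_and negbK => /andP[/andP[ib ia] iQ].
  rewrite iQ andbT; case/orP: ia => [/eqP ia|//]; by rewrite -ia iQ in aQ.
by apply/subsetPn; exists b; rewrite in_setD ?bQ ?bP // P'E setU11.
Qed.
End Kasteleyn.

(** * The minors of the system as sums over matchings *)

Local Close Scope group_scope.
Local Open Scope ring_scope.

Section Expansion.
Variables (n : nat) (G : bgraph n).
Local Notation H := (half_edge G).
Local Notation V := (ivert G + 'I_n)%type.
Local Notation m := #|black_inner G|.
Implicit Types P Q : {set edge G}.
Variables (R : comNzRingType) (w : edge G -> R).

(** The row of a white vertex u has one term for each half-edge at u and, if u is on
  the boundary, one more term None that stands for z_u itself. *)
Definition row_term (u : V) (o : option H) : bool :=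
  match o with Some h => vert h == u | None => if u is inr _ then true else false end.

Definition term_column (u : V) (o : option H) : V :=
  match o with Some h => vert (flip h) | None => u end.

(** The equation of a white boundary vertex i with neighbor v reads z_i - w z_v = 0,
  hence the sign. *)
Definition half_weight (h : H) : R := if map_vertex h == None then - w h.1 else w h.1.

Definition term_weight (o : option H) : R := if o is Some h then half_weight h else 1.

(** The coefficient in column c of the equation of the white vertex u, once each
  half-edge variable is expressed by the variable of a black or of a boundary vertex. *)
Definition network_entry (u c : V) : R :=
  \sum_(o | row_term u o && (term_column u o == c)) term_weight o.

Variables (k : nat) (y : 'I_(k + m) -> V).
Hypotheses (y_inj : injective y) (y_white : forall q, ~~ black G (y q)).
Hypothesis rows_card : #|white_vertices G| = (k + m)%N.

Lemma y_onto u : ~~ black G u -> exists q, y q = u.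
Proof.
move=> ub; have : y @: setT = white_vertices G.
  apply/eqP; rewrite eqEcard card_imset // cardsT card_ord rows_card leqnn andbT.
  by apply/subsetP=> _ /imsetP[q _ ->]; rewrite inE.
by move=> /setP/(_ u); rewrite inE ub => /imsetP[q _ ->]; exists q.
Qed.

Section Minor.
Variable f : 'I_k -> 'I_n.
Hypothesis f_inj : injective f.

Definition network_minor := \matrix_(q, j) network_entry (y q) (column f j).

Definition matching_sign P : {perm 'I_(k + m)} :=
  odflt 1%g [pick s : {perm 'I_(k + m)} | [forall q, column f (s q) == mate P (y q)]].

Definition matching_terms P : {ffun 'I_(k + m) -> option H} :=
  [ffun q => [pick h : half_edge G | (vert h == y q) && (h.1 \in P)]].

Definition terms_edges (g : {ffun 'I_(k + m) -> option H}) : {set edge G} :=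
  [set e | [exists q, g q == Some (e, false)]].

Definition valid_terms (s : {perm 'I_(k + m)}) (g : {ffun 'I_(k + m) -> option H}) :=
  [forall q, row_term (y q) (g q) && (term_column (y q) (g q) == column f (s q))].

Lemma matching_signE P (s : {perm 'I_(k + m)}) :
  (forall q, column f (s q) = mate P (y q)) -> matching_sign P = s.
Proof.
move=> sE; rewrite /matching_sign; case: pickP => [s' /forallP s'E|/(_ s)].
  apply/permP=> q; apply: (column_inj f_inj).
  by rewrite sE (eqP (s'E q)).
by move=> /negbT/forallPn[q]; rewrite sE eqxx.
Qed.

Lemma white_half (h : H) : ~~ black G (vert h) -> h = (h.1, false).
Proof. by rewrite vert_black; case: h => e []. Qed.

(** A choice of one term in each row with distinct columns f meets every interior vertex
  and the boundary vertices of f once, so its edges form a matching, from which the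
  choice can be read off. *)
Lemma valid_termsP s g : valid_terms s g ->
  let P := terms_edges g in
  [/\ almost_perfect P, matching_boundary P = [set f i | i : 'I_k],
    matching_sign P = s & matching_terms P = g].
Proof.
move=> /forallP val P.
have gS q h : g q = Some h -> [/\ vert h = y q, vert (flip h) = column f (s q) & h.1 \in P].
  move=> gq; have := val q; rewrite gq /= => /andP[/eqP hy /eqP hc]; split=> //.
  rewrite inE; apply/existsP; exists q; rewrite gq -white_half //.
  by rewrite hy.
have gN q : g q = None -> exists2 i, y q = inr i & column f (s q) = inr i.
  move=> gq; have := val q; rewrite gq /=; case: (y q) => // i /eqP <-; by exists i.
have inP e : e \in P -> exists q, g q = Some (e, false).
  by rewrite inE => /existsP[q /eqP gq]; exists q.
have AP : almost_perfect P.
  apply/almost_perfectP => v; case vb: (black G (inl v)).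
    have [j jv] := column_black f vb; set q := (s^-1 j)%g.
    have sq : s q = j by rewrite permKV.
    case gq: (g q) => [h|]; last first.
      by have [i _] := gN _ gq; rewrite sq jv.
    have [hy hc hP] := gS _ _ gq; exists (flip h); first by rewrite hc sq jv.
    move=> [e b] hv eP; have [q' gq'] := inP _ eP.
    have [_ hc' _] := gS _ _ gq'.
    have b1 : b = true by have := vert_black (e, b); rewrite hv vb.
    rewrite b1 in hv *; have : column f (s q') = column f (s q) by rewrite -hc' hv sq jv.
    by move=> /(column_inj f_inj)/perm_inj E; move: gq; rewrite -E gq' => -[<-].
  have [|q qv] := @y_onto (inl v); first by rewrite vb.
  case gq: (g q) => [h|]; last by have [i] := gN _ gq; rewrite qv.
  have [hy hc hP] := gS _ _ gq; exists h; first by rewrite hy qv.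
  move=> [e b] hv eP; have [q' gq'] := inP _ eP; have [hy' _ _] := gS _ _ gq'.
  have b0 : b = false by have := vert_black (e, b); rewrite hv vb.
  rewrite b0 in hv *; have : y q' = y q by rewrite -hy' hv qv.
  by move=> /y_inj E; move: gq; rewrite -E gq' => -[<-].
have unused q i : g q = None -> y q = inr i -> used P i = false.
  move=> gq yq; apply/negP=> /inP[q' gq'].
  have ib : ~~ black G (inr i) by rewrite -yq.
  have := ib; rewrite -(vert_bhalf G i) => /white_half E; rewrite -E in gq'.
  have [hy _ _] := gS _ _ gq'; rewrite vert_bhalf -yq in hy.
  by move: gq'; rewrite -(y_inj hy) gq.
have mE q : column f (s q) = mate P (y q).
  case gq: (g q) => [h|].
    by have [<- <- hP] := gS _ _ gq; rewrite mateE.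
  by have [i yq ->] := gN _ gq; rewrite yq mate_unused // (unused q i).
split=> //.
- apply/eqP; rewrite eqEcard card_imset // card_ord; apply/andP; split; last first.
    by rewrite -(leq_add2r m) -rows_card (card_matching_boundary AP).
  apply/subsetP=> i; rewrite mem_boundary; case uP: (used P i) => /eqP/esym ib.
    have [q gq] := inP _ uP; have [_ hc _] := gS _ _ gq.
    have E : flip ((bhalf G i).1, false) = bhalf G i.
      by rewrite /flip /= -ib -bhalf2 -surjective_pairing.
    rewrite E vert_bhalf in hc.
    have := column_codom (s q) (erefl [set f i | i : 'I_k]); by rewrite -hc.
  have [|q qi] := @y_onto (inr i); first by rewrite ib.
  case gq: (g q) => [h|].
    have [hy _ hP] := gS _ _ gq; rewrite qi in hy.
    by move: uP; rewrite /used -(vert_inr hy) hP.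
  have [i' yq hc] := gN _ gq; have := column_codom (s q) (erefl [set f i | i : 'I_k]).
  by rewrite hc; move: yq; rewrite qi => -[->].
- exact: matching_signE.
- apply/ffunP=> q; rewrite ffunE; case gq: (g q) => [h|].
    have [hy _ hP] := gS _ _ gq; case: pickP => [h' /andP[/eqP hy' hP']|/(_ h)].
      by congr Some; apply: (unique_at AP); rewrite ?hy.
    by rewrite hy eqxx hP.
  have [i yq _] := gN _ gq; case: pickP => // h /andP[/eqP]; rewrite yq => /vert_inr ->.
  by rewrite -/(used P i) (unused q i).
Qed.

Lemma matching_valid P : almost_perfect P -> matching_boundary P = [set f i | i : 'I_k] ->
  valid_terms (matching_sign P) (matching_terms P) /\ terms_edges (matching_terms P) = P.
Proof.
move=> AP fP; have [s sE] := matching_perm y_inj y_white AP f_inj fP.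
rewrite (matching_signE sE); split.
  apply/forallP=> q; rewrite ffunE sE; case: pickP => [h /andP[/eqP hy hP]|no] /=.
    by rewrite hy eqxx /= -hy (mateE AP hP) eqxx.
  case yq: (y q) => [v|i].
    have [h [hv hP] _] := almost_perfectP _ AP v; have := no h; by rewrite hv yq eqxx hP.
  rewrite mate_unused ?eqxx //; apply/negP=> uP; have := no (bhalf G i).
  by rewrite vert_bhalf yq eqxx -/(used P i) uP.
apply/setP=> e; rewrite inE; apply/existsP/idP => [[q]|eP].
  by rewrite ffunE; case: pickP => // h /andP[_ hP] /eqP[E]; rewrite E in hP.
have [|q qv] := @y_onto (vert ((e, false) : H)); first by rewrite vert_black.
exists q; rewrite ffunE; case: pickP => [h /andP[/eqP hy hP]|/(_ (e, false))].
  apply/eqP; congr Some; apply: (unique_at AP) => //.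
  by rewrite hy qv.
by rewrite qv eqxx eP.
Qed.

Lemma prod_terms P : almost_perfect P ->
  \prod_q term_weight (matching_terms P q) = \prod_(e in P) half_weight (e, false).
Proof.
move=> AP; transitivity (\prod_q \prod_(e in P | vert ((e, false) : H) == y q) half_weight (e, false)).
  apply: eq_bigr => q _; rewrite ffunE; case: pickP => [h /andP[/eqP hy hP]|no] /=.
    have hE : h = (h.1, false) by apply: white_half; rewrite hy.
    rewrite (big_pred1 h.1) -?hE // => e /=; apply/andP/eqP => [[eP /eqP ev]|->].
      by rewrite (unique_at AP (_ : vert h = vert ((e, false) : H))) // ev hy.
    by rewrite -hE hy.
  by rewrite big_pred0 // => e; have := no (e, false); rewrite andbC.
rewrite (exchange_big_dep (mem P)) /=; last by move=> q e _ /andP[].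
apply: eq_bigr => e eP.
have [|q qv] := @y_onto (vert ((e, false) : H)); first by rewrite vert_black.
by rewrite (big_pred1 q) // => q' /=; rewrite -qv eP (inj_eq y_inj) eq_sym.
Qed.

(** The entries of the minor are sums, so the Leibniz formula expands into choices of
  one term in each row; these correspond to matchings. *)
Lemma det_network_minor : \det network_minor =
  \sum_(P | almost_perfect P && (matching_boundary P == [set f i | i : 'I_k]))
    (-1) ^+ matching_sign P * \prod_(e in P) half_weight (e, false).
Proof.
transitivity (\sum_(p : {perm 'I_(k + m)} * {ffun 'I_(k + m) -> option H} | valid_terms p.1 p.2)
   (-1) ^+ p.1 * \prod_q term_weight (p.2 q)).
  rewrite /determinant.
  under eq_bigr => s _ do under eq_bigr => q _ do rewrite mxE /network_entry.
  under eq_bigr => s _ do rewrite bigA_distr_big_dep mulr_sumr.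
  rewrite pair_big_dep /=; apply: eq_bigl => -[s g] /=.
  by apply/familyP/forallP => h q; have := h q.
rewrite (reindex_onto (fun P => (matching_sign P, matching_terms P)) (fun p => terms_edges p.2)) /=.
  apply: eq_big => [P|P /andP[val /eqP PE]].
    apply/andP/andP => [[/valid_termsP[AP fP _ _] /eqP PE]|[AP /eqP fP]].
      by rewrite PE in AP fP; rewrite AP fP eqxx.
    by have [-> ->] := matching_valid AP fP.
  have [AP _ _ _] := valid_termsP val; rewrite PE in AP.
  by rewrite prod_terms.
by move=> [s g] /= /valid_termsP[_ _ -> ->].
Qed.

End Minor.
End Expansion.

(** * The relation space *)

Lemma addr_cancel_left (U : zmodType) (a b c : U) : c = b + (a - b - (a - c)).
Proof. by rewrite addrA [b + (a - b)]addrC subrK opprB addrC subrK. Qed.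

Lemma subr_cancel_left (U : zmodType) (a b c : U) : b - c = (a - c) - (a - b).
Proof. by rewrite opprB [RHS]addrC addrA subrK. Qed.

Section RelationSpace.
Variables (n : nat) (G : bgraph n).
Local Notation H := (half_edge G).
Local Notation V := (ivert G + 'I_n)%type.
Local Notation m := #|black_inner G|.
Variables (R : fieldType) (w : edge G -> R).
Variables (k : nat) (y : 'I_(k + m) -> V).
Hypotheses (y_inj : injective y) (y_white : forall q, ~~ black G (y q)).
Hypothesis rows_card : #|white_vertices G| = (k + m)%N.

Definition boundary_columns : 'M[R]_(k + m, n) := \matrix_(q, i) network_entry w (y q) (inr i).
Definition inner_columns : 'M[R]_(k + m, m) :=
  \matrix_(q, x) network_entry w (y q) (inl (enum_val x)).

Lemma sum_option (U : nmodType) (T : finType) (P : pred (option T)) (F : option T -> U) :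
  \sum_(o | P o) F o = (if P None then F None else 0) + \sum_(t | P (Some t)) F (Some t).
Proof.
rewrite big_mkcond (bigD1 None) //=; congr (_ + _).
rewrite [RHS]big_mkcond [LHS](reindex_omap (@Some T) id) /=; last by case.
by apply: eq_big => [t|t _]; rewrite ?eqxx.
Qed.

(** Scalar values of F describe solutions of the system, and values that are half-edge
  variables describe its consequences. *)
Lemma network_row (U : lmodType R) (F : V -> U) q :
  \sum_i boundary_columns q i *: F (inr i) + \sum_x inner_columns q x *: F (inl (enum_val x))
  = \sum_(o | row_term (y q) o) term_weight w o *: F (term_column (y q) o).
Proof.
have term_ok o : row_term (y q) o -> term_column (y q) o \in
    [set c | if c is inl v then black G (inl v) else true].
  case: o => [h|] /= ho; rewrite inE.
    case E: (vert (flip h)) => [v|//].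
    by rewrite -E black_flip (eqP ho).
  by move: ho; case: (y q).
transitivity (\sum_(c | c \in [set c | if c is inl v then black G (inl v) else true])
    network_entry w (y q) c *: F c).
  apply/esym; rewrite big_sumType /= addrC; congr (_ + _).
    by apply: eq_big => [i|i _]; rewrite ?inE ?mxE.
  rewrite (eq_bigl (mem (black_inner G))) => [|v]; last by rewrite !inE.
  by rewrite big_enum_val; apply: eq_bigr => x _; rewrite mxE.
under eq_bigr => c _ do rewrite scaler_suml.
rewrite (exchange_big_dep (row_term (y q))) /=; last by move=> c o _ /andP[].
apply: eq_bigr => o ho; rewrite (big_pred1 (term_column (y q) o)) // => c.
rewrite ho /= eq_sym; case: eqP => [->|]; rewrite ?andbF // andbT; exact: term_ok.
Qed.

Lemma network_row_inl (U : lmodType R) (F : V -> U) u :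
  \sum_(o | row_term (inl u) o) term_weight w o *: F (term_column (inl u) o)
  = \sum_(h : H | vert h == inl u) w h.1 *: F (vert (flip h)).
Proof.
rewrite sum_option add0r; apply: eq_bigr => h /eqP hu.
by rewrite /= /half_weight /map_vertex hu.
Qed.

Lemma network_row_inr (U : lmodType R) (F : V -> U) i :
  \sum_(o | row_term (inr i) o) term_weight w o *: F (term_column (inr i) o)
  = F (inr i) - w (bhalf G i).1 *: F (vert (flip (bhalf G i))).
Proof.
rewrite sum_option /= scale1r; congr (_ + _).
rewrite (big_pred1 (bhalf G i)) => [|h]; last by rewrite /= bhalfP.
by rewrite /half_weight map_vertex_bhalf eqxx scaleNr.
Qed.

Lemma network_minorE f : network_minor w y f = row_mx (colsub f boundary_columns) inner_columns.
Proof.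
by apply/matrixP=> q j; rewrite !mxE /column; case: (split j) => x; rewrite !mxE.
Qed.

Section Basis.
Variable f0 : 'I_k -> 'I_n.
Hypothesis minor_neq0 : \det (network_minor w y f0) != 0.
Let N0 := network_minor w y f0.

Let N0_unit : N0 \in unitmx.
Proof. by rewrite unitmxE unitfE. Qed.

(* The rows of L span the left kernel of the inner columns. *)
Let L := usubmx (invmx N0).
Let L' := dsubmx (invmx N0).

Let inv_mul :
  [/\ L *m colsub f0 boundary_columns = 1%:M, L *m inner_columns = 0 & L' *m inner_columns = 1%:M].
Proof.
have := mulVmx N0_unit; rewrite -[invmx N0]vsubmxK -/L -/L' /N0 network_minorE mul_col_row.
by rewrite scalar_mx_block => /eq_block_mx[].
Qed.

Definition relation_basis : 'M[R]_(k, n) := L *m boundary_columns.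

(** Multiplication by the inverse of N0 makes the minor block triangular. *)
Lemma det_relation_basis f :
  \det (colsub f relation_basis) = \det (network_minor w y f) / \det N0.
Proof.
have -> : colsub f relation_basis = L *m colsub f boundary_columns.
  by apply/matrixP=> i j; rewrite !mxE; apply: eq_bigr => q _; rewrite !mxE.
rewrite mulrC -det_inv -det_mulmx -[invmx N0]vsubmxK -/L -/L' network_minorE mul_col_row.
by have [_ -> ->] := inv_mul; rewrite det_lblock det1 mulr1.
Qed.

Let hspace := {ffun half_edge G -> R^o}.
Notation Sp := (<<relation_system w>>%VS).

Lemma edge_relation_in e : edge_relation w e \in Sp.
Proof. by apply: memv_span; rewrite mem_cat; apply/orP; left; apply: map_f; rewrite mem_enum. Qed.

Lemma black_relation_in (h h' : H) v :
  vert h = inl v -> vert h' = inl v -> h.2 -> black_relation R h h' \in Sp.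
Proof.
move=> hv hv' hb; apply: memv_span; rewrite !mem_cat; apply/orP; right; apply/orP; left.
apply/flattenP; eexists.
  by apply/mapP; exists v; rewrite // mem_filter mem_enum -hv vert_black hb.
by apply/allpairsP; exists (h, h'); rewrite !mem_enum !inE hv hv' eqxx.
Qed.

Lemma white_relation_in u : ~~ black G (inl u) -> white_relation R u \in Sp.
Proof.
move=> ub; apply: memv_span; rewrite !mem_cat; apply/orP; right; apply/orP; right.
by apply/mapP; exists u; rewrite // mem_filter mem_enum ub.
Qed.

(** Modulo the system all half-edge variables at a black interior vertex agree, so any
  of them may represent it. *)
Definition column_var (c : V) : hspace :=
  match c with
  | inr i => zvar R (bhalf G i)
  | inl v => if [pick h : half_edge G | vert h == inl v] is Some h then zvar R h else 0
  end.

Lemma column_var_in (h : H) : h.2 || (map_vertex h == None) ->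
  zvar R h - column_var (vert h) \in Sp.
Proof.
rewrite /map_vertex; case E: (vert h) => [v|i] /= hb; last by rewrite (vert_inr E) subrr mem0v.
case: pickP => [g /eqP gv|/(_ h)]; last by rewrite E eqxx.
by apply: (black_relation_in E gv); rewrite orbF in hb.
Qed.

Lemma flip_white (h : H) : ~~ h.2 -> w h.1 *: zvar R (flip h) - zvar R h \in Sp.
Proof. by case: h => e [] // _; exact: edge_relation_in. Qed.

Lemma row_in_span q :
  \sum_i boundary_columns q i *: column_var (inr i)
  + \sum_x inner_columns q x *: column_var (inl (enum_val x)) \in Sp.
Proof.
rewrite network_row; case yq: (y q) (y_white q) => [u|i] ub.
  rewrite network_row_inl.
  have -> : \sum_(h : H | vert h == inl u) w h.1 *: column_var (vert (flip h)) =
     white_relation R u + \sum_(h : H | vert h == inl u)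
       ((w h.1 *: zvar R (flip h) - zvar R h) - w h.1 *: (zvar R (flip h) - column_var (vert (flip h)))).
    rewrite -big_split /=; apply: eq_bigr => h _.
    by rewrite scalerBr; exact: addr_cancel_left.
  apply: memvD; first exact: white_relation_in.
  apply: memv_suml => h /eqP hu; have h2 : ~~ h.2 by rewrite -vert_black hu.
  by apply: memvB; [exact: flip_white | apply/memvZ/column_var_in; rewrite /= h2].
rewrite network_row_inr /=; set h := bhalf G i.
have h2 : ~~ h.2 by rewrite bhalf2.
have -> : zvar R h - w h.1 *: column_var (vert (flip h)) =
  w h.1 *: (zvar R (flip h) - column_var (vert (flip h))) - (w h.1 *: zvar R (flip h) - zvar R h).
  by rewrite scalerBr; exact: subr_cancel_left.
by apply: memvB; [apply/memvZ/column_var_in; rewrite /= h2 | exact: flip_white].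
Qed.

(** The combination L of the rows of the system cancels the variables of all black
  interior vertices. *)
Lemma basis_row_in j : row j relation_basis \in Rel w.
Proof.
pose z : hspace := \sum_i relation_basis j i *: zvar R (bhalf G i).
have zc : boundary_coords z = row j relation_basis.
  apply/rowP=> i; rewrite [RHS]mxE [LHS]mxE /z sum_ffunE (bigD1 i) //= !ffunE eqxx big1 ?addr0.
    exact: mulr1.
  move=> i' ne; rewrite !ffunE (inj_eq (@bhalf_inj _ G)) eq_sym (negbTE ne).
  exact: mulr0.
have -> : row j relation_basis = linfun (@boundary_coords R n G) z by rewrite lfunE /= zc.
apply: memv_img; rewrite memv_cap; apply/andP; split; last first.
  apply: memv_suml => i _; apply/memvZ/memv_span; apply: map_f; exact: mem_enum.
have -> : z = \sum_q L j q *: (\sum_i boundary_columns q i *: column_var (inr i)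
  + \sum_x inner_columns q x *: column_var (inl (enum_val x))).
  under eq_bigr => q _ do rewrite scalerDr !scaler_sumr.
  rewrite big_split /= exchange_big [X in _ + X]exchange_big /=.
  rewrite [X in _ + X]big1 ?addr0 => [|x _].
    apply: eq_bigr => i _; rewrite mxE scaler_suml; apply: eq_bigr => q _.
    by rewrite scalerA.
  have [_ /matrixP/(_ j x) + _] := inv_mul; rewrite !mxE => E.
  under eq_bigr => q _ do rewrite scalerA.
  by rewrite -scaler_suml E scale0r.
by apply: memv_suml => q _; apply/memvZ/row_in_span.
Qed.

Lemma span_eval (X : seq hspace) (zeta : H -> R) (z : hspace) :
  z \in <<X>>%VS -> (forall g, g \in X -> \sum_h g h * zeta h = 0) ->
  \sum_h z h * zeta h = 0.
Proof.
move=> zX X0; rewrite (coord_span (X := in_tuple X) zX).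
rewrite (eq_bigr (fun h => \sum_i coord (in_tuple X) i z * (X`_i h * zeta h))); last first.
  by move=> h _; rewrite sum_ffunE mulr_suml; apply: eq_bigr => i _; rewrite ffunE -mulrA.
rewrite exchange_big big1 // => i _.
by rewrite -mulr_sumr X0 ?mulr0 //; exact: mem_nth.
Qed.

Lemma zvar_eval (g : H) (zeta : H -> R) : \sum_h zvar R g h * zeta h = zeta g.
Proof.
rewrite (bigD1 g) //= ffunE eqxx mul1r big1 ?addr0 // => h /negbTE hg.
by rewrite ffunE hg mul0r.
Qed.

(** X extends to a solution zeta of the whole system, and the consequences of a system
  vanish on its solutions. *)
Lemma relations_annihilate (X : V -> R) :
  (forall q, \sum_i boundary_columns q i * X (inr i)
     + \sum_x inner_columns q x * X (inl (enum_val x)) = 0) ->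
  forall z, z \in (Sp :&: boundary_space R G)%VS ->
    \sum_i z (bhalf G i) * X (inr i) = 0.
Proof.
move=> X0 z; rewrite memv_cap => /andP[zS zV].
have X0' q : \sum_(o | row_term (y q) o) term_weight w o * X (term_column (y q) o) = 0.
  by rewrite -[RHS](X0 q); symmetry; exact: (@network_row R^o X q).
pose zeta (h : H) := if h.2 then X (vert h) else w h.1 * X (vert (flip h)).
have zeta_bd i : zeta (bhalf G i) = X (inr i).
  rewrite /zeta bhalf2; case ib: (black G (inr i)); first by rewrite vert_bhalf.
  have [|q qi] := y_onto y_inj y_white rows_card (u := inr i); first by rewrite ib.
  have := X0' q; rewrite qi (@network_row_inr R^o X) => /eqP.
  by rewrite subr_eq0 => /eqP E; exact: esym E.
have z_int h : map_vertex h != None -> z h = 0.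
  move=> hv; rewrite -(zvar_eval h (fun g => z g)).
  under eq_bigr => g _ do rewrite mulrC ffunE eq_sym.
  rewrite (eq_bigr (fun g => z g * (g == h)%:R)); last by move=> g _; rewrite eq_sym.
  apply: (span_eval zV) => _ /mapP[i _ ->].
  rewrite zvar_eval; case: eqP => // E.
  by move: hv; rewrite -E map_vertex_bhalf.
transitivity (\sum_h z h * zeta h).
  rewrite [RHS](bigID (fun h => map_vertex h == None)) /= [X in _ = _ + X]big1 ?addr0; last first.
    by move=> h hv; rewrite z_int // mul0r.
  rewrite [RHS](eq_bigl (mem (bhalf G @: setT))); last first.
    move=> h; apply/eqP/imsetP => [/map_vertex_None[i ->]|[i _ ->]]; first by exists i.
    exact: map_vertex_bhalf.
  rewrite big_imset /=; last by move=> i j _ _ /bhalf_inj.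
  by apply: eq_big => [i|i _]; rewrite ?inE ?zeta_bd.
apply: (span_eval zS) => g; rewrite !mem_cat => /or3P[].
- move=> /mapP[e _ ->].
  rewrite (eq_bigr (fun h => w e * (zvar R (e, true) h * zeta h) - zvar R (e, false) h * zeta h)).
    by rewrite sumrB -mulr_sumr !zvar_eval /zeta /= /flip /= subrr.
  by move=> h _; rewrite !ffunE mulrBl mulrA.
- move=> /flattenP[_ /mapP[v + ->]]; rewrite mem_filter => /andP[vb _].
  move=> /allpairsP[[h h'] /= [+ + ->]]; rewrite !mem_enum !inE => /eqP hv /eqP hv'.
  rewrite (eq_bigr (fun g => zvar R h g * zeta g - zvar R h' g * zeta g)).
    by rewrite sumrB !zvar_eval /zeta -!vert_black hv hv' vb subrr.
  by move=> g' _; rewrite !ffunE mulrBl.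
- move=> /mapP[u + ->]; rewrite mem_filter => /andP[ub _].
  rewrite (eq_bigr (fun g => \sum_(h : half_edge G | vert h == inl u) zvar R h g * zeta g)); last first.
    by move=> h _; rewrite sum_ffunE mulr_suml.
  rewrite exchange_big /=.
  have [q qu] := y_onto y_inj y_white rows_card ub.
  have := X0' q; rewrite qu (@network_row_inl R^o X) => E; rewrite -[RHS]E.
  apply: eq_bigr => h /eqP hu; rewrite zvar_eval /zeta.
  by rewrite (_ : h.2 = false) //; apply/negbTE; rewrite -vert_black hu.
Qed.

(** A boundary vector killed by relation_basis extends to a solution of the system, with
  the values at the black interior vertices read off from L'. Hence v vanishes on the
  cokernel of relation_basis. *)
Lemma Rel_sub_basis v : v \in Rel w -> (v <= relation_basis)%MS.
Proof.
move=> /memv_imgP[z zS ->]; rewrite lfunE /= submxE; apply/eqP/rowP=> j.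
rewrite [RHS]mxE; set K := cokermx _.
pose xn := col j K; pose xB := - (L' *m (boundary_columns *m xn)).
have Kn : relation_basis *m xn = 0 by rewrite /xn colE mulmxA mulmx_coker mul0mx.
have sol : boundary_columns *m xn + inner_columns *m xB = 0.
  have [_ E2 E3] := inv_mul.
  apply: (can_inj (mulKmx (_ : invmx N0 \in unitmx))); first by rewrite unitmx_inv.
  rewrite mulmx0 -[invmx N0]vsubmxK -/L -/L' mul_col_mx !mulmxDr !mulmxA E2 E3 -/relation_basis.
  by rewrite Kn mul0mx mul1mx /xB mulmxA addr0 subrr col_mx0.
pose X (c : V) : R := match c with inr i => xn i 0
  | inl v => \sum_x (if enum_val x == v then xB x 0 else 0) end.
have XE x : X (inl (enum_val x)) = xB x 0.
  rewrite /X (bigD1 x) //= eqxx big1 ?addr0 // => x' ne.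
  by rewrite (inj_eq enum_val_inj) (negbTE ne).
have Xrow q : \sum_i boundary_columns q i * X (inr i)
    + \sum_x inner_columns q x * X (inl (enum_val x)) = 0.
  have := congr1 (fun M : 'cV_(k + m) => M q 0) sol; rewrite [in RHS]mxE => E.
  rewrite -[RHS]E mxE; congr (_ + _); rewrite mxE; apply: eq_bigr => // x _.
  by rewrite XE.
rewrite mxE -[RHS](relations_annihilate Xrow zS); apply: eq_bigr => i _.
rewrite [boundary_coords z 0 i]mxE; congr (_ * _).
by rewrite /X /xn [RHS]mxE.
Qed.

Lemma relation_basis_mul : relation_basis *m colsub f0 1%:M = 1%:M.
Proof.
have [<- _ _] := inv_mul.
apply/matrixP=> i j.
have E x : colsub f0 1%:M x j = (x == f0 j)%:R :> R by rewrite !mxE.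
rewrite mxE (bigD1 (f0 j)) //= E eqxx mulr1 big1 ?addr0 => [|x /negbTE ne]; last by rewrite E ne mulr0.
by rewrite [LHS]mxE [RHS]mxE; apply: eq_bigr => q _; congr (_ * _); rewrite [RHS]mxE.
Qed.

Lemma Rel_basis : Rel w = <<[seq row i relation_basis | i : 'I_k]>>%VS.
Proof.
apply/eqP; rewrite eqEsubv; apply/andP; split; last first.
  by apply/span_subvP => _ /mapP[i _ ->]; exact: basis_row_in.
apply/subvP=> v /Rel_sub_basis/submxP[D ->].
rewrite mulmx_sum_row; apply: memv_suml => i _; apply/memvZ/memv_span.
by apply: map_f; rewrite mem_enum.
Qed.

Lemma dim_Rel : \dim (Rel w) = k.
Proof.
have fr : free [tuple row i relation_basis | i < k].
  apply/freeP => c c0 i; pose D := \row_i c i.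
  have D0 : D *m relation_basis = 0.
    rewrite mulmx_sum_row -[RHS]c0; apply: eq_bigr => j _.
    by rewrite mxE (nth_map j) ?size_enum_ord // nth_ord_enum.
  have := congr1 (fun M : 'rV_n => (M *m colsub f0 1%:M) 0 i) D0.
  by rewrite -mulmxA relation_basis_mul mulmx1 mul0mx !mxE.
by move: fr; rewrite /free size_tuple Rel_basis => /eqP.
Qed.

End Basis.
End RelationSpace.

(** * The expected dimension and the theorem *)

Section Degrees.
Variables (n : nat) (G : bgraph n).
Local Notation H := (half_edge G).

Lemma sum_degrees (c : bool) :
  (\sum_(v : ivert G | black G (inl v) == c) degree v + #|[set i : 'I_n | black G (inr i) == c]|
   = #|edge G|)%N.
Proof.
have -> : #|edge G| = #|[set h : H | h.2 == c]|.
  rewrite -(card_imset _ (_ : injective (fun e : edge G => (e, c)))); last by move=> e e' [].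
  apply: eq_card => h; rewrite inE; apply/imsetP/eqP => [[e _ ->] //|<-].
  by exists h.1; rewrite // -surjective_pairing.
rewrite -(cardsID [set h : H | map_vertex h == None]) addnC; congr (_ + _)%N.
  rewrite -(card_imset _ (@bhalf_inj _ G)); apply: eq_card => h; rewrite !inE.
  apply/imsetP/andP => [[i]|[/eqP hc /eqP/map_vertex_None[i hi]]].
    by rewrite inE => /eqP ic ->; rewrite bhalf2 map_vertex_bhalf ic !eqxx.
  by exists i; rewrite // inE -bhalf2 -hi hc.
rewrite (eq_bigr (fun v => \sum_(h : H | vert h == inl v) 1)%N); last first.
  by move=> v _; rewrite sum1_card /degree; apply: eq_card => h; rewrite !inE.
rewrite (exchange_big_dep (mem ([set h : H | h.2 == c] :\: [set h | map_vertex h == None]))) /=.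
  rewrite -sum1_card; apply: eq_bigr => h; rewrite !inE => /andP[hv /eqP hc].
  case v: (map_vertex h) hv => [u|//] _; have /map_vertex_int hu := v.
  rewrite (big_pred1 u) // => v'; rewrite hu /= (inj_eq (@inl_inj _ _)) [u == v']eq_sym.
  by case: (v' =P u) => [->|]; rewrite ?andbF // -hu vert_black hc eqxx.
move=> v h /eqP vc /eqP hv; rewrite !inE -vert_black hv vc eqxx andbT.
by rewrite /map_vertex hv.
Qed.

(** The edges are counted by their black ends and by their white ends. *)
Lemma kN_rows (k : nat) : #|white_vertices G| = (k + #|black_inner G|)%N ->
  kN G = k%:R.
Proof.
move=> rows_card.
have wB := sum_degrees false; have bB := sum_degrees true.
rewrite (eq_bigl (fun v => black G (inl v))) in bB; last by move=> v; rewrite eqb_id.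
rewrite (eq_bigl (fun v => ~~ black G (inl v))) in wB; last by move=> v; rewrite eqbF_neg.
have split_n : (#|[set i : 'I_n | black G (inr i) == true]|
    + #|[set i : 'I_n | black G (inr i) == false]| = n)%N.
  rewrite -[RHS]card_ord -(cardsC [set i : 'I_n | black G (inr i) == true]).
  by congr (_ + _)%N; apply: eq_card => i; rewrite !inE; case: (black _ _).
have white_split : (#|white_vertices G| = #|[set v : ivert G | ~~ black G (inl v)]|
   + #|[set i : 'I_n | black G (inr i) == false]|)%N.
  rewrite -!sum1_card big_mkcond big_sumType /= -!big_mkcond /=.
  by congr (_ + _)%N; apply: eq_bigl => x; rewrite !inE // eqbF_neg.
have sum_split (P : pred (ivert G)) : \sum_(v | P v) ((degree v)%:R - 2 : rat) =
    (\sum_(v | P v) degree v)%:R - 2 * #|[set v | P v]|%:R.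
  rewrite sumrB natr_sum; congr (_ - _).
  by rewrite -(sum1_card (mem [set v | P v])) natr_sum mulr_sumr; apply: eq_big => v; rewrite ?inE ?mulr1.
have -> : kN G = (n%:R + \sum_(v | black G (inl v)) ((degree v)%:R - 2 : rat)
   - \sum_(v | ~~ black G (inl v)) ((degree v)%:R - 2 : rat)) / 2.
  rewrite /kN; congr (_ / _); congr (_ + _); rewrite -sumrN.
  by apply: eq_bigr => v _; rewrite opprB.
rewrite !sum_split.
have E : (n + \sum_(v | black G (inl v)) degree v + 2 * #|[set v : ivert G | ~~ black G (inl v)]| =
   2 * k + 2 * #|black_inner G| + \sum_(v | ~~ black G (inl v)) degree v)%N by lia.
have := congr1 (fun x => x%:R : rat) E; rewrite !natrD !addr0 /black_inner => E'.
by lra.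
Qed.

End Degrees.

Lemma prod_signr (R : comNzRingType) (I : finType) (P : pred I) (b : I -> bool) :
  \prod_(i | P i) (-1) ^+ b i = (-1) ^+ (\big[addb/false]_(i | P i) b i) :> R.
Proof. by apply/esym/(big_morph (fun c : bool => (-1) ^+ c : R)) => // c d; rewrite signr_addb. Qed.

Theorem theorem14p6 (R : realType) (n : nat) (G : planar_bgraph n)
    (hG : exists Pi : {set edge G}, almost_perfect Pi) :
  exists eps : edge G -> R,
    (forall e, eps e = 1 \/ eps e = -1) /\
    forall t : edge G -> R, (forall e, 0 < t e) ->
      Rel_defined (signed_weight t eps) /\
      is_matching_point (signed_weight t (fun _ => 1))
        (Rel (signed_weight t eps)).
Proof.
have [P0 AP0] := hG.
set m := #|black_inner G|; pose k := #|matching_boundary P0|.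
have rows_card : #|white_vertices G| = (k + m)%N := card_matching_boundary AP0.
pose y (q : 'I_(k + m)) : ivert G + 'I_n := enum_val (cast_ord (esym rows_card) q).
have y_inj : injective y by move=> q q' /enum_val_inj/cast_ord_inj.
have y_white q : ~~ black G (y q).
  by have := enum_valP (cast_ord (esym rows_card) q); rewrite inE.
have card_bd (P : {set edge G}) : almost_perfect P -> #|matching_boundary P| = k.
  by move=> AP; apply/eqP; rewrite -(eqn_add2r m) -rows_card (card_matching_boundary AP).
have [eps epsE] := kasteleyn_signs y_inj y_white rows_card hG.
have [f0 f0_inc f0P] := increasing_enumeration (card_bd _ AP0).
have [s0 s0E] := matching_perm y_inj y_white AP0 (increasing_inj f0_inc) f0P.
pose on_boundary e := map_vertex ((e, false) : half_edge G) == None.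
(* The sign on_boundary compensates the one of half_weight. *)
exists (fun e => (-1) ^+ (eps e (+) on_boundary e)); split=> [e|t t_gt0].
  by case: (_ (+) _); [right; rewrite expr1 | left].
set w := signed_weight t _.
pose c := odd_perm s0 (+) \big[addb/false]_(e in P0) eps e.
have w_half e : half_weight w (e, false) = (-1) ^+ eps e * t e.
  rewrite /half_weight /w /signed_weight /= -/(on_boundary e) signr_addb.
  by case: (on_boundary e); rewrite ?expr0 ?mulr1 // expr1 mulrN1 mulNr opprK.
have minorE (f : 'I_k -> 'I_n) : increasing f -> \det (network_minor w y f) =
    (-1) ^+ c * matching_plucker (signed_weight t (fun _ => 1)) [set f j | j : 'I_k].
  move=> f_inc; rewrite (det_network_minor _ y_inj y_white rows_card (increasing_inj f_inc)).
  rewrite /matching_plucker mulr_sumr; apply: eq_bigr => P /andP[AP /eqP fP].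
  have [s sE] := matching_perm y_inj y_white AP (increasing_inj f_inc) fP.
  rewrite (matching_signE (increasing_inj f_inc) sE).
  under eq_bigr => e _ do rewrite w_half.
  rewrite big_split /= prod_signr mulrA -signr_addb.
  rewrite (epsE P P0 f f0 s s0) // -/c; congr (_ * _).
  by apply: eq_bigr => e _; rewrite /signed_weight mul1r.
have minor0 : \det (network_minor w y f0) != 0.
  rewrite minorE // mulf_neq0 ?signr_eq0 // -f0P /matching_plucker.
  have pos P : 0 < \prod_(e in P) signed_weight t (fun _ => 1) e.
    by apply: prodr_gt0 => e _; rewrite /signed_weight mul1r.
  rewrite (bigD1 P0) ?AP0 ?eqxx //=; apply: lt0r_neq0.
  by apply: ltr_wpDr; rewrite // sumr_ge0 // => P _; exact: ltW.
have dimR : \dim (Rel w) = k by exact: dim_Rel y_inj y_white rows_card _ minor0.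
split; first by rewrite /Rel_defined dimR (kN_rows rows_card).
exists k; split=> [P AP|]; first exact: card_bd.
exists (relation_basis w y f0); split=> //.
  exact: Rel_basis y_inj y_white rows_card _ minor0.
exists ((-1) ^+ c / \det (network_minor w y f0)).
  by rewrite mulf_neq0 ?signr_eq0 ?invr_neq0.
by move=> f f_inc; rewrite (det_relation_basis minor0) minorE // mulrAC.
Qed.
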